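(* Let $F\in S_1(\mathcal B,\varepsilon)$, with respect to a Hilbert basis $\mathcal B=(e_j)_{j\in\Gamma}$, where the family $(\varepsilon_j)_{j\in\Gamma}$ is summable. Then, for every $h>0$ and every $q\in[1,+\infty[$, $F$ admits a stochastic extension in $L^q(B^2,\mu_{B^2,h})$. Moreover, for all $h_0>0$ and $q_0\in]1,+\infty[$, there exists a function $\widetilde F$ which is the stochastic extension of $F$ in $L^q(B^2,\mu_{B^2,h})$ for all $h\in]0,h_0]$ and $q\in[1,q_0]$. For any $E\in\mathcal F(H^2)$ and all $(h,q)\in]0,h_0]\times[1,q_0]$, $$\|F\circ\tilde\pi_E-\widetilde F\|_{L^q(B^2,\mu_{B^2,h})}\le\|F\|_{1,\varepsilon}\,K(q)\,h^{1/2}\sum_{j\in\Gamma}\varepsilon_j\big(|u_j-\pi_E(u_j)|+|v_j-\pi_E(v_j)|\big).$$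
   Context: Wiener space. $H$ is a real, separable, infinite dimensional Hilbert space with scalar product $\langle\cdot,\cdot\rangle$ and norm $|\cdot|$; $B$ is the Banach space obtained by completing $H$ for a measurable norm (in the sense of Gross), and $H$ is identified with its dual, so that $B'\subset H\subset B$. For $h>0$, $\mu_{B,h}$ is the Gaussian probability measure of variance $h$ on the Borel $\sigma$-algebra of $B$: for $y_1,\dots,y_n\in B'$ orthonormal in $H$, the image of $\mu_{B,h}$ under $x\mapsto (y_1(x),\dots,y_n(x))$ is $(2\pi h)^{-n/2}e^{-|v|^2/(2h)}dv$ on $\mathbb R^n$. For $a\in H$, $\ell_a\in L^2(B,\mu_{B,h})$ is the image of $a$ under the continuous extension to $H$ of the map $B'\ni y\mapsto y(\cdot)$. $\mathcal F(H)$ is the set of finite dimensional subspaces of $H$; for $E\in\mathcal F(H)$ with orthonormal basis $(w_1,\dots,w_n)$, $\pi_E$ is the orthogonal projection onto $E$ and $\tilde\pi_E(x)=\sum_j\ell_{w_j}(x)w_j$ for $x\in B$. A Borel function $f$ on $H$ admits $\tilde f$ as a stochastic extension in $L^p(B,\mu_{B,h})$ if, for every increasing sequence $(E_n)$ in $\mathcal F(H)$ with dense union in $H$, $f\circ\tilde\pi_{E_n}\in L^p(B,\mu_{B,h})$ and $f\circ\tilde\pi_{E_n}\to\tilde f$ in $L^p(B,\mu_{B,h})$. All this is used likewise for $(H^2,B^2,\mu_{B^2,h})$. Symbol classes. $\mathcal B=(e_j)_{j\in\Gamma}$ is a Hilbert basis of $H$ ($\Gamma$ countable) with all $e_j\in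 B'$; $u_j=(e_j,0)$, $v_j=(0,e_j)$. For $m\in\mathbb N$, $M\ge0$ and a family $\varepsilon=(\varepsilon_j)_{j\in\Gamma}$ of nonnegative reals, $S_m(\mathcal B,M,\varepsilon)$ is the set of bounded continuous $F:H^2\to\mathbb C$ such that for every pair of finitely supported multi-indices $(\alpha,\beta)$ with $0\le\alpha_j,\beta_j\le m$ for all $j$, the derivative $\prod_{j}\partial_{u_j}^{\alpha_j}\partial_{v_j}^{\beta_j}F$ exists, is continuous on $H^2$ and is bounded in modulus by $M\prod_j\varepsilon_j^{\alpha_j+\beta_j}$. $S_m(\mathcal B,\varepsilon)=\bigcup_{M\ge0}S_m(\mathcal B,M,\varepsilon)$, normed by $\|F\|_{m,\varepsilon}=\inf\{M\ge0: F\in S_m(\mathcal B,M,\varepsilon)\}$. Constant: $K(q)=2^{1/2}\pi^{-1/(2q)}\left(\Gamma\left(\frac{q+1}2\right)\right)^{1/q}$ (here $\Gamma(\cdot)$ is Euler's Gamma function). *)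

(* Defs.v *)
From HB Require Import structures.
From mathcomp Require Import all_boot all_order all_algebra.
From mathcomp Require Import finmap sesquilinear.
From mathcomp Require Import complex.
From mathcomp Require Import all_classical all_reals all_analysis.

Set Implicit Arguments.
Unset Strict Implicit.
Unset Printing Implicit Defensive.

Import Order.TTheory GRing.Theory Num.Theory.
Import numFieldNormedType.Exports.

Local Open Scope classical_set_scope.
Local Open Scope ring_scope.

(* [sesquilinear] also exports an [orthonormal] on sequences; the notions below
   concern families indexed by an arbitrary type.

   A Hilbert space is a [normedModType R] with an inner product [ip] whose
   associated norm [hnorm ip] defines the topology.  [hnorm ip] need not be the
   norm of the [normedModType]: on a product the library uses the max norm. *)

Notation borel T := (g_sigma_algebraType (@open T)).

Notation modulus := (ComplexField.Normc.normc).

Section HilbertSpace.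
Context {R : realType} {V : normedModType R}.
Variable ip : V -> V -> R.

Definition hnorm (x : V) : R := Num.sqrt (ip x x).

Definition linspan {I : Type} (b : I -> V) : set V :=
  [set x | exists (s : seq I) (c : I -> R), x = \sum_(i <- s) c i *: b i].

Definition findim (E : set V) : Prop :=
  exists (n : nat) (b : 'I_n -> V), E = linspan b.

Definition orthonormal_family {I : eqType} (b : I -> V) : Prop :=
  forall i j : I, ip (b i) (b j) = (i == j)%:R.

Definition orthonormal_basis (E : set V) (n : nat) (w : 'I_n -> V) : Prop :=
  orthonormal_family w /\ linspan w = E.

Definition hilbert_basis {I : eqType} (e : I -> V) : Prop :=
  orthonormal_family e /\ dense (linspan e).

(* For finite dimensional E, the set below is a singleton. *)
Definition orthoproj (E : set V) (x : V) : V :=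
  xget 0 [set y | E y /\ forall z, E z -> ip (x - y) z = 0].

End HilbertSpace.

Section GaussianMeasure.
Context {R : realType}.

(* Iterated Lebesgue integral: for measurable g >= 0 it is, by Tonelli's
   theorem, the integral of g over R^n. *)
Fixpoint lebesgue_integral_tuple (n : nat) : (n.-tuple R -> \bar R) -> \bar R :=
  match n with
  | 0 => fun g => g [tuple]
  | n'.+1 => fun g => (\int[lebesgue_measure]_(x in [set: R])
      lebesgue_integral_tuple (fun v : n'.-tuple R => g [tuple of x :: v]))%E
  end.

Definition gaussian_density (n : nat) (h : R) (v : n.-tuple R) : R :=
  (2 * pi * h) `^ (- (n%:R / 2)) *
  expR (- (\sum_(j < n) tnth v j ^+ 2) / (2 * h)).

Definition gaussian_tuple (n : nat) (h : R) (A : set (n.-tuple R)) : \bar R :=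
  lebesgue_integral_tuple
    (fun v => (gaussian_density h v * \1_A v)%:E).

End GaussianMeasure.

Section WienerSpace.
Context {R : realType}.

(* Gross: the canonical Gauss measure of a finite dimensional subspace F
   is the image of the standard Gaussian measure by v |-> \sum_j v_j w_j,
   for any orthonormal basis w of F. *)
Definition measurable_norm (V : normedModType R) (ip : V -> V -> R)
    (N : V -> R) : Prop :=
  [/\ forall x y, N (x + y) <= N x + N y,
      forall (a : R) x, N (a *: x) = `|a| * N x,
      forall x, N x = 0 -> x = 0 &
      forall eps : R, 0 < eps -> exists E0 : set V, findim E0 /\
        forall (n : nat) (w : 'I_n -> V), orthonormal_family ip w ->
          (forall j x, E0 x -> ip (w j) x = 0) ->
          (gaussian_tuple 1
             [set v : n.-tuple R | (eps < N (\sum_(j < n) tnth v j *: w j))%R]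
           < eps%:E)%E].

Definition separable (T : topologicalType) : Prop :=
  exists2 S : set T, countable S & dense S.

Definition wiener_space (H B : completeNormedModType R)
    (ip : H -> H -> R) (i : H -> B) : Prop :=
  [/\ forall x : H, `|x| = hnorm ip x,
      separable H,
      ~ findim [set: H],
      measurable_norm ip (fun x => `|i x|) &
      dense (range i)].

Section Dual.
Context {V W : normedModType R}.
Variables (ip : V -> V -> R) (i : V -> W).

(* [phi] in W' is identified with the element [a] of V. *)
Definition dual_repr (phi : {linear W -> R^o}) (a : V) : Prop :=
  continuous phi /\ forall x, phi (i x) = ip a x.

Definition in_dual (a : V) : Prop := exists phi, dual_repr phi a.

Definition wiener_measure (h : R) (mu : probability (borel W) R) : Prop :=
  forall (n : nat) (y : 'I_n -> V) (phi : 'I_n -> {linear W -> R^o}),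
    orthonormal_family ip y -> (forall j, dual_repr (phi j) (y j)) ->
    forall A : set (n.-tuple R), measurable A ->
      mu [set x | A [tuple phi j x | j < n]] = gaussian_tuple h A.

Local Open Scope ereal_scope.

(* [ell] picks a representative [ell a] of the class written $\ell_a$: up to almost
   everywhere equality, [ell] is the continuous extension to V of the map
   sending an element of W' to itself in L^2. *)
Definition is_ell (mu : probability (borel W) R) (ell : V -> W -> R) : Prop :=
  [/\ forall a, (ell a : borel W -> R) \in Lfun mu 2%:E,
      forall a (phi : {linear W -> R^o}), dual_repr phi a ->
        {ae mu, forall x, ell a x = phi x} &
      forall a, Lnorm mu 2%:E (fun x => (ell b x - ell a x)%:E) @[b --> a] --> 0].

(* Version of $\tilde\pi_E$, for an orthonormal basis [w] of E. *)
Definition tilde_proj (ell : V -> W -> R) (n : nat) (w : 'I_n -> V) (x : W) : V :=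
  (\sum_(j < n) ell (w j) x *: w j)%R.

Definition borel_function (f : V -> R[i]) : Prop :=
  measurable_fun [set: borel V] (fun x : borel V => complex.Re (f x)) /\
  measurable_fun [set: borel V] (fun x : borel V => complex.Im (f x)).

Definition cLnorm (mu : probability (borel W) R) (p : R) (g : W -> R[i]) :
  \bar R := Lnorm mu p%:E (fun x => (modulus (g x))%:E).

Definition in_cLp (mu : probability (borel W) R) (p : R) (g : W -> R[i]) : Prop :=
  [/\ measurable_fun [set: borel W] (fun x : borel W => complex.Re (g x)),
      measurable_fun [set: borel W] (fun x : borel W => complex.Im (g x)) &
      cLnorm mu p g < +oo].

Definition stochastic_extension (mu : probability (borel W) R)
    (ell : V -> W -> R) (p : R) (f : V -> R[i]) (g : W -> R[i]) : Prop :=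
  [/\ borel_function f,
      in_cLp mu p g &
      forall E : nat -> set V,
        (forall n, findim (E n)) ->
        (forall n, E n `<=` E n.+1) ->
        dense (\bigcup_n E n) ->
        forall (d : nat -> nat) (w : forall n, 'I_(d n) -> V),
          (forall n, orthonormal_basis ip (E n) (w n)) ->
          (forall n, in_cLp mu p (f \o tilde_proj ell (w n))) /\
          (fun n => cLnorm mu p ((f \o tilde_proj ell (w n)) \- g)%R)
            @ \oo --> 0].

End Dual.

Definition ip_pair (H : normedModType R) (ip : H -> H -> R) (x y : H * H) : R :=
  ip x.1 y.1 + ip x.2 y.2.

Definition map_pair (H B : Type) (i : H -> B) (x : H * H) : B * B :=
  (i x.1, i x.2).

End WienerSpace.

Section SymbolClass.
Context {R : realType}.

Section ComplexDerivative.
Context {V : normedModType R}.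
Implicit Types (F : V -> R[i]) (v x : V).

Definition ccontinuous F : Prop :=
  continuous (fun x => complex.Re (F x) : R) /\
  continuous (fun x => complex.Im (F x) : R).

Definition cderivable F x v : Prop :=
  derivable (fun y => complex.Re (F y) : R^o) x v /\
  derivable (fun y => complex.Im (F y) : R^o) x v.

Definition cderive F v x : R[i] :=
  (derive (fun y => complex.Re (F y) : R^o) x v +i*
   derive (fun y => complex.Im (F y) : R^o) x v)%C.

Definition iter_cderive F (s : seq V) : V -> R[i] :=
  foldr (fun v G => cderive G v) F s.

Fixpoint iter_cderivable F (s : seq V) : Prop :=
  if s is v :: s' then
    iter_cderivable F s' /\ forall x, cderivable (iter_cderive F s') x v
  else True.

End ComplexDerivative.

Context {H : normedModType R} {J : countType}.
Variable e : J -> H.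

Definition direction (d : J + J) : H * H :=
  match d with inl j => (e j, 0) | inr j => (0, e j) end.

(* [s] lists the successive factors of
   $\prod_j \partial_{u_j}^{\alpha_j}\partial_{v_j}^{\beta_j}$, in some order. *)
Definition lists_multi_index (alpha beta : {fsfun J -> nat with 0%N})
    (s : seq (J + J)) : Prop :=
  forall j, count_mem (inl j) s = alpha j /\ count_mem (inr j) s = beta j.

(* The derivatives are required in every order of differentiation: when all of
   those occurring here are continuous, they do not depend on the order. *)
Definition symbol_class (m : nat) (M : R) (eps : J -> R) (F : H * H -> R[i]) :
    Prop :=
  [/\ ccontinuous F,
      exists C : R, forall x, modulus (F x) <= C &
      forall alpha beta : {fsfun J -> nat with 0%N},
        (forall j, (alpha j <= m)%N /\ (beta j <= m)%N) ->
        forall s, lists_multi_index alpha beta s ->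
        let D := map direction s in
        [/\ iter_cderivable F D,
            ccontinuous (iter_cderive F D) &
            forall x, modulus (iter_cderive F D x) <=
              M * \prod_(j <- (finsupp alpha `|` finsupp beta)%fset)
                    eps j ^+ (alpha j + beta j)]].

Definition symbol_space (m : nat) (eps : J -> R) (F : H * H -> R[i]) : Prop :=
  exists2 M : R, 0 <= M & symbol_class m M eps F.

Definition symbol_norm (m : nat) (eps : J -> R) (F : H * H -> R[i]) : R :=
  inf [set M : R | 0 <= M /\ symbol_class m M eps F].

End SymbolClass.

Section Constant.
Context {R : realType}.

Definition Gamma (s : R) : R :=
  \int[lebesgue_measure]_(t in `]0, +oo[) (t `^ (s - 1) * expR (- t)).

Definition Kconst (q : R) : R :=
  2 `^ (1 / 2) * pi `^ (- (1 / (2 * q))) * Gamma ((q + 1) / 2) `^ (1 / q).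

End Constant.

(* Main.v *)
(** The symbol [F] is Lipschitz in the weighted [l^1] sense
    [|F X - F Y| <= ||F|| \sum_k eps_k |<b_k, X - Y>|], where [b] enumerates the
    directions [u_j], [v_j]: apply the mean value theorem one coordinate at a
    time, then use density and the continuity of [F].  Each [b_k] is represented
    by a continuous functional [phi_k] of variance at most [h], so
    [\sum_k eps_k |phi_k x|] is finite almost surely, for every [h] at once, and
    where it is finite [F (\sum_(k < n) phi_k x b_k)] is a Cauchy sequence.  Its
    limit is the extension, it depends neither on [h] nor on [q], and it inherits
    [|F Y - Ft x| <= ||F|| \sum_k eps_k |<b_k, Y> - phi_k x|].  At
    [Y = tilde_proj x] the term [<b_k, Y> - phi_k x] is a Gaussian variable, namely
    [ell] at [pi_E b_k - b_k]; Minkowski's inequality and the absolute moments of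
    the normal law give the estimate, and dominated convergence of the series
    gives the convergence along increasing subspaces. *)

From HB Require Import structures.
Require Import Defs.
From mathcomp Require Import all_boot all_order all_algebra.
From mathcomp Require Import finmap sesquilinear.
From mathcomp Require Import complex.
From mathcomp Require Import all_classical all_reals all_analysis.
From mathcomp Require Import measurable_realfun normal_distribution exponential_distribution.
From mathcomp Require Import ring lra.

Set Implicit Arguments.
Unset Strict Implicit.
Unset Printing Implicit Defensive.

Import Order.TTheory GRing.Theory Num.Theory.
Import numFieldNormedType.Exports.

Local Open Scope classical_set_scope.
Local Open Scope ring_scope.

(** * Absolute moments of the normal law *)

(** The measures [mu h] for different [h] are mutually singular, so an L^q limit taken under one of
    them says nothing under another, and [ell h a] is only a representative of a class that itself
    depends on [h]. Hence the extension is a pointwise limit built from the continuous functionals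
    [phi k], which are genuine functions defined without any measure; a measure enters only to show
    that the exceptional set is null. [tilde_proj] is nevertheless expressed through [ell], about
    which one knows just its values on the dual and its continuity in L^2. L^2 convergence alone
    would not control L^q norms for [q > 2]; approximation at a geometric rate gives almost
    everywhere convergence, and Fatou's lemma then carries the bounds over to every [q]. The number
    [Kconst q * h ^ (1/2)] is the L^q norm of a centred normal variable of variance [h]; upper
    bounds on that norm suffice throughout. The norm of a product space is the maximum norm, not
    [hnorm (ip_pair ip)], so the Hilbert geometry is developed for an abstract inner product whose
    norm is merely dominated by the ambient one. *)

Section GaussianMoments.
Context {R : realType}.
Notation mu := (@lebesgue_measure R).

Lemma powR_continuous_gt0 (r x : R) : 0 < x -> {for x, continuous (@powR R ^~ r)}.
Proof.
move=> x0; apply: differentiable_continuous; apply/derivable1_diffP.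
by apply: derivable_powR; rewrite in_itv/= x0.
Qed.

Lemma Gamma_integrand_ge0 (r u : R) : 0 <= u `^ r * expR (- u).
Proof. by rewrite mulr_ge0// ?powR_ge0 ?expR_ge0. Qed.

Lemma measurable_Gamma_integrand (r : R) (D : set R) :
  measurable_fun D (EFin \o (fun u : R => u `^ r * expR (- u))).
Proof.
apply/measurable_EFinP/measurable_funTS; apply: measurable_funM.
  exact: measurable_powR.
by apply: measurableT_comp.
Qed.

Lemma continuous_Gamma_integrand (r u : R) : 0 < u ->
  {for u, continuous (fun u : R => u `^ r * expR (- u))}.
Proof.
move=> u0; apply: continuousM; first exact: powR_continuous_gt0.
by apply: continuous_comp; [exact: continuousN|exact: continuous_expR].
Qed.

(** Substitution [u = t^2 / (2h)], under which [t^q dt] becomes [h (2h)^((q-1)/2) u^((q-1)/2) du]. A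
    segment away from 0 keeps the powers continuous; the image segment covers only part of the
    half-line, hence an inequality. *)
Lemma gauss_half_moment_itv (h q a b : R) : 0 < h -> 1 <= q -> 0 < a -> a <= b ->
  (\int[mu]_(t in `[a, b]) (t `^ q * expR (- t ^+ 2 / (2 * h)))%:E <=
   (h * (2 * h) `^ ((q - 1) / 2))%:E *
   \int[mu]_(u in `]0%R, +oo[) (u `^ ((q - 1) / 2) * expR (- u))%:E)%E.
Proof.
move=> h0 q1 a0 ab.
have h20 : 0 < 2 * h by rewrite mulr_gt0.
pose F (t : R) : R := t ^+ 2 / (2 * h).
pose r : R := (q - 1) / 2.
pose G (u : R) : R := u `^ r * expR (- u).
have F'E : (derive1 F) = (fun t : R => t / h).
  apply/funext => t; rewrite /F derive1E deriveMr//= exp_derive /= expr1 /GRing.scale/=.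
  by rewrite mulr1; field; rewrite gt_eqF.
have dF t : derivable F t 1.
  by apply/derivable1_diffP; rewrite /F; apply: differentiableM.
have cF t : {for t, continuous F}.
  by apply: differentiable_continuous; exact/derivable1_diffP.
have cF' t : {for t, continuous (derive1 F)}.
  by rewrite F'E; apply: cvgMl; exact: cvg_id.
have := @integration_by_substitution_increasing R F G a b ab.
have -> : (\int[mu]_(x in `[a, b]) (((G \o F) * (derive1 F)) x)%:E =
   \int[mu]_(x in `[a, b]) ((h * (2 * h) `^ r)^-1%:E * (x `^ q * expR (- x ^+ 2 / (2 * h)))%:E))%E.
  apply: eq_integral => t; rewrite inE/= in_itv/= => /andP[at_ tb].
  have t0 : 0 < t by exact: lt_le_trans at_.
  rewrite -EFinM; congr EFin.
  rewrite F'E /G /F !fctE -mulNr powRM ?sqr_ge0 ?invr_ge0 ?ltW//.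
  rewrite -powR_mulrn ?ltW// -powRrM -[(2 * h)^-1]powR_inv1 ?ltW// -powRrM mulN1r powRN.
  have -> : t `^ q = t `^ (2%:R * r) * t.
    rewrite -{3}[t]powRr1 ?ltW// -powRD ?(gt_eqF t0) ?implybT//.
    by rewrite /r; congr (_ `^ _); field.
  rewrite invfM. set c := (_ `^ r)^-1; field.
  by rewrite gt_eqF.
rewrite ge0_integralZl; last 4 first.
- exact: measurable_itv.
- apply/measurable_EFinP/measurable_funTS; apply: measurable_funM; first exact: measurable_powR.
  apply: measurableT_comp => //; apply: measurable_funM => //.
  apply: measurableT_comp => //; exact: measurable_funX.
- by move=> x _; rewrite lee_fin mulr_ge0 ?powR_ge0 ?expR_ge0.
- by rewrite lee_fin invr_ge0 mulr_ge0 ?powR_ge0 ?ltW.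
move=> H; rewrite -lee_pdivrMl; last by rewrite mulr_gt0 ?powR_gt0.
rewrite -H.
- apply: ge0_subset_integral => //=.
  + exact: measurable_Gamma_integrand.
  + by move=> x _; rewrite lee_fin Gamma_integrand_ge0.
  + move=> x /=; rewrite !in_itv/= andbT => /andP[+ _]; apply: lt_le_trans.
    by rewrite divr_gt0 ?exprn_gt0.
- move=> x y; rewrite !in_itv/= => /andP[ax _] /andP[ay _] xy.
  have [x0 y0] := (lt_le_trans a0 ax, lt_le_trans a0 ay).
  by rewrite /F ltr_pM2r ?invr_gt0// ltr_pXn2r// nnegrE ltW.
- by move=> x _; exact: cF'.
- by apply/cvg_ex; exists ((derive1 F) a); apply: cvg_at_right_filter; exact: cF'.
- by apply/cvg_ex; exists ((derive1 F) b); apply: cvg_at_left_filter; exact: cF'.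
- split=> //.
  + by apply: cvg_at_right_filter; exact: cF.
  + by apply: cvg_at_left_filter; exact: cF.
- apply: continuous_in_subspaceT => x; rewrite inE/= in_itv/= => /andP[Fx _].
  by apply: continuous_Gamma_integrand; apply: lt_le_trans Fx; rewrite divr_gt0 ?exprn_gt0.
Qed.


(** The bound on segments does not depend on the segment, so monotone convergence along segments
    increasing to the open half-line preserves it. *)
Lemma gauss_half_moment (h q : R) : 0 < h -> 1 <= q ->
  (\int[mu]_(t in `]0%R, +oo[) (t `^ q * expR (- t ^+ 2 / (2 * h)))%:E <=
   (h * (2 * h) `^ ((q - 1) / 2))%:E *
   \int[mu]_(u in `]0%R, +oo[) (u `^ ((q - 1) / 2) * expR (- u))%:E)%E.
Proof.
move=> h0 q1; pose I (n : nat) : set R := `[n.+1%:R^-1, n.+1%:R]%classic.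
have : forall n, (\int[mu]_(t in I n) (t `^ q * expR (- t ^+ 2 / (2 * h)))%:E <=
   (h * (2 * h) `^ ((q - 1) / 2))%:E *
   \int[mu]_(u in `]0%R, +oo[) (u `^ ((q - 1) / 2) * expR (- u))%:E)%E.
  move=> n; apply: gauss_half_moment_itv => //.
  by rewrite (@le_trans _ _ 1)// ?invf_le1 ?ler1n.
have -> : `]0%R, +oo[%classic = \bigcup_n I n.
  apply/seteqP; split=> [x|x [n _]]; rewrite /I /= !in_itv/= ?andbT; last first.
    by move=> /andP[+ _]; apply: lt_le_trans; rewrite invr_gt0.
  (* With this index, [n + 1] exceeds both [x] and [1 / x]. *)
  move=> x0; exists (maxn (Num.truncn x) (Num.truncn x^-1)) => //=.
  rewrite in_itv/=; apply/andP; split.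
    rewrite invf_ple ?posrE//; apply: le_trans (ltW (truncnS_gt _)) _.
    by rewrite ler_nat ltnS leq_maxr.
  apply: le_trans (ltW (truncnS_gt _)) _.
  by rewrite ler_nat ltnS leq_maxl.
move=> gm.
have mf (D : set R) :
    measurable_fun D (EFin \o (fun t : R => t `^ q * expR (- t ^+ 2 / (2 * h)))).
  apply/measurable_EFinP/measurable_funTS; apply: measurable_funM; first exact: measurable_powR.
  apply: measurableT_comp => //; apply: measurable_funM => //.
  apply: measurableT_comp => //; exact: measurable_funX.
have ndI : nondecreasing_seq I.
  apply/nondecreasing_seqP => n; rewrite subsetEset; apply: subset_itv.
    by rewrite bnd_simp lef_pV2 ?posrE// ler_nat.
  by rewrite bnd_simp ler_nat.
have f0 i t : I i t -> (0 <= (t `^ q * expR (- t ^+ 2 / (2 * h)))%:E)%E.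
  by move=> _; rewrite lee_fin mulr_ge0 ?powR_ge0 ?expR_ge0.
have := @ge0_nondecreasing_set_cvg_integral _ (measurableTypeR R) R I _ mu ndI
  (fun n => measurable_itv _) (fun n => mf _) f0.
apply: cvge_le; by near=> n; exact: gm.
Unshelve. all: by end_near. Qed.

(** Half of the exponential decay absorbs the power [u^r]; what remains is a multiple of the
    exponential density of rate 1/2, whose own factor 1/2 explains the constant [C * 2] below. *)
Lemma Gamma_integral_lty (r : R) : 0 <= r ->
  (\int[mu]_(u in `]0%R, +oo[) (u `^ r * expR (- u))%:E < +oo)%E.
Proof.
move=> r0.
(* from [ln x <= x] at [x = u / (2 (r + 1))] *)
have [C C0 HC] : exists2 C : R, 0 <= C &
    forall u, 0 < u -> u `^ r * expR (- u) <= C * expR (- (2^-1 * u)).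
  pose c := 2 * (r + 1); have c0 : 0 < c by rewrite mulr_gt0 ?ltr_wpDl.
  exists (c `^ r) => [|u u0]; first exact: powR_ge0.
  have -> : u `^ r = c `^ r * (u / c) `^ r.
    by rewrite -powRM ?divr_ge0 ?ltW// mulrC divfK// gt_eqF.
  rewrite -mulrA ler_wpM2l ?powR_ge0//.
  rewrite /powR gt_eqF ?divr_gt0// -expRD ler_expR.
  have : ln (u / c) <= u / c.
    rewrite -ler_expR lnK ?posrE ?divr_gt0//; by apply: le_trans (expR_ge1Dx _); rewrite lerDr.
  move=> /(ler_wpM2l r0) H.
  have : r * (u / c) <= 2^-1 * u.
    rewrite /c mulrCA [leRHS]mulrC ler_pM2l// ler_pdivrMr ?mulr_gt0 ?ltr_wpDl//; lra.
  by move: H; lra.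
have r20 : 0 < 2^-1 :> R by [].
apply: (@le_lt_trans _ _ (\int[mu]_u ((C * 2)%:E * (exponential_pdf 2^-1 u)%:E))%E).
  rewrite [leLHS]integral_mkcond; apply: ge0_le_integral => //=.
  - move=> u _; apply: erestrict_ge0 => v _; rewrite lee_fin; exact: Gamma_integrand_ge0.
  - apply/(measurable_restrictT _ (measurable_itv _)); exact: measurable_Gamma_integrand.
  - apply: measurable_funeM; apply/measurable_EFinP; exact: measurable_exponential_pdf.
  move=> u _; rewrite patchE; case: ifPn => [|_]; last first.
    by rewrite mule_ge0// lee_fin ?mulr_ge0// exponential_pdf_ge0// ltW.
  rewrite inE/= in_itv/= andbT => u0.
  rewrite -EFinM lee_fin exponential_pdfE; last exact: ltW.
  apply: le_trans (HC u u0) _.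
  by rewrite mulrA mulfK// -mulNr.
rewrite ge0_integralZl//=; last 3 first.
- apply/measurable_EFinP; exact: measurable_exponential_pdf.
- by move=> u _; rewrite lee_fin exponential_pdf_ge0// ltW.
- by rewrite lee_fin mulr_ge0.
by rewrite integral_exponential_pdf// mule1 ltry.
Qed.

Lemma normal_pdf_sqrt (h t : R) : 0 < h ->
  normal_pdf 0 (Num.sqrt h) t = (2 * h * pi) `^ (- 2^-1) * expR (- t ^+ 2 / (2 * h)).
Proof.
move=> h0; have s0 : Num.sqrt h != 0 by rewrite gt_eqF// sqrtr_gt0.
rewrite normal_pdfE// /normal_peak /normal_fun subr0 sqr_sqrtr ?ltW//.
by rewrite powRN powR12_sqrt ?mulr_ge0 ?pi_ge0 ?ltW// !mulr_natl mulrnAl.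
Qed.

Lemma Kconst_powR_ge0 (h q : R) : 0 <= Kconst q * h `^ (1 / 2).
Proof.
by apply: mulr_ge0; [rewrite /Kconst; do ?[apply: mulr_ge0]|]; exact: powR_ge0.
Qed.

(** Origin of [Kconst]: by symmetry the moment is twice the half-line integral, and [2 (2 pi
    h)^(-1/2) h (2h)^((q-1)/2) Gamma((q+1)/2)] is exactly the q-th power of [Kconst q * h^(1/2)]. *)
Lemma integral_powR_normal_pdf (h q : R) : 0 < h -> 1 <= q ->
  (\int[mu]_t (`|t| `^ q * normal_pdf 0 (Num.sqrt h) t)%:E <=
   ((Kconst q * h `^ (1 / 2)) `^ q)%:E)%E.
Proof.
move=> h0 q1.
have s0 : Num.sqrt h != 0 by rewrite gt_eqF// sqrtr_gt0.
have q0 : 0 < q by exact: lt_le_trans q1.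
have h20 : 0 < 2 * h by rewrite mulr_gt0.
have pdfE t := @normal_pdf_sqrt h t h0.
have pdf_cont : continuous (normal_pdf 0 (Num.sqrt h)) by exact: continuous_normal_pdf.
have cf : continuous (fun t : R => `|t| `^ q * normal_pdf 0 (Num.sqrt h) t).
  move=> t; apply: (@cvgM _ _ _ _ (fun t : R => `|t| `^ q) (normal_pdf 0 (Num.sqrt h)));
    last exact: pdf_cont.
  have [->|t0] := eqVneq t 0; last first.
    apply: (@continuous_comp _ _ _ (@Num.norm R R) (@powR R ^~ q)); first exact: norm_continuous.
    by apply: powR_continuous_gt0; rewrite normr_gt0.
  (* Continuity at 0 uses [q >= 1]: on the unit ball [|u|^q <= |u|], hence the radius [min 1 e]. *)
  apply/cvgrPdist_le => e e0; apply/nbhs_ballP.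
  exists (Num.min 1 e); first by rewrite /= lt_min ltr01.
  move=> u /=; rewrite sub0r normrN lt_min => /andP[u1 ue].
  rewrite normr0 powR0 ?gt_eqF// sub0r normrN ger0_norm ?powR_ge0//.
  have [->|u0] := eqVneq u 0; first by rewrite normr0 powR0 ?gt_eqF// ltW.
  by apply: le_trans (ge1r_powR _ q1) (ltW ue); rewrite normr_gt0 u0 ltW.
rewrite ge0_symfun_integralT//; last 2 first.
- by move=> t; rewrite mulr_ge0 ?powR_ge0// normal_pdf_ge0.
- by move=> t /=; rewrite normrN !pdfE sqrrN.
rewrite -set_itvcy -integral_itv_obnd_cbnd; last first.
  by apply/measurable_EFinP/measurable_funTS; exact: continuous_measurable_fun.
have -> : (\int[mu]_(t in `]0%R, +oo[) (`|t| `^ q * normal_pdf 0 (Num.sqrt h) t)%:E =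
   \int[mu]_(t in `]0%R, +oo[)
     (((2 * h * pi) `^ (- 2^-1))%:E * (t `^ q * expR (- t ^+ 2 / (2 * h)))%:E))%E.
  apply: eq_integral => t; rewrite inE/= in_itv/= andbT => t0.
  by rewrite -EFinM pdfE gtr0_norm// mulrCA.
rewrite ge0_integralZl//=; last 3 first.
- apply/measurable_EFinP/measurable_funTS; apply: measurable_funM; first exact: measurable_powR.
  apply: measurableT_comp => //; apply: measurable_funM => //.
  apply: measurableT_comp => //; exact: measurable_funX.
- by move=> t _; rewrite lee_fin mulr_ge0 ?powR_ge0 ?expR_ge0.
- by rewrite lee_fin powR_ge0.
apply: le_trans.
  apply: lee_wpmul2l; first by [].
  apply: lee_wpmul2l; first by rewrite lee_fin powR_ge0.
  exact: gauss_half_moment.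
have r0 : 0 <= (q - 1) / 2 by rewrite divr_ge0// subr_ge0.
have -> : (\int[mu]_(u in `]0%R, +oo[) (u `^ ((q - 1) / 2) * expR (- u))%:E)%E =
    (Gamma ((q + 1) / 2))%:E.
  have -> : (q - 1) / 2 = (q + 1) / 2 - 1 by lra.
  rewrite /Gamma /Rintegral fineK// ge0_fin_numE.
    by apply: Gamma_integral_lty; lra.
  by apply: integral_ge0 => u _; rewrite lee_fin Gamma_integrand_ge0.
have G0 : 0 <= Gamma ((q + 1) / 2) by apply: Rintegral_ge0 => u _; exact: Gamma_integrand_ge0.
rewrite -!EFinM lee_fin /Kconst.
have hge0 := ltW h0; rewrite !powRM ?mulr_ge0 ?powR_ge0 ?pi_ge0//.
rewrite -!powRrM.
have -> : 1 / q * q = 1 by rewrite divfK ?gt_eqF.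
have -> : - (1 / (2 * q)) * q = - 2^-1 by field; rewrite gt_eqF.
rewrite powRr1//.
have powD (a s t : R) : 0 < a -> a `^ s * a `^ t = a `^ (s + t).
  by move=> a0; rewrite powRD// (gt_eqF a0) implybT.
(* The exponents satisfy [q/2 = 1 - 1/2 + (q-1)/2]. For [a = 2] the three factors come from
   symmetry, from the normalisation of the density and from the substitution; for [a = h] the first
   comes from the substitution as well. *)
have split_half (a : R) : 0 < a ->
    a `^ (1 / 2 * q) = a * (a `^ (- 2^-1) * a `^ ((q - 1) / 2)).
  move=> a0; rewrite powD// -[X in _ = X * _]powRr1 ?(ltW a0)// powD//.
  by congr (_ `^ _); field.
rewrite (split_half 2)// (split_half h)//; rewrite le_eqVlt; apply/orP; left; apply/eqP; ring.
Qed.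

End GaussianMoments.

(** * Estimates in L^p *)

Lemma series_le_lim {R : realType} (u : R^nat) n : (forall k, 0 <= u k) ->
  cvgn (series u) -> \sum_(0 <= k < n) u k <= limn (series u).
Proof.
move=> u0 cu; have -> : \sum_(0 <= k < n) u k = series u n by rewrite seriesEnat.
apply: (nondecreasing_cvgn_le _ cu).
by apply/nondecreasing_seqP => m; rewrite !seriesEnat/= big_nat_recr//= lerDl.
Qed.

Section LpConvergence.
Context d (T : measurableType d) {R : realType} (P : probability T R).
Local Open Scope ereal_scope.

Lemma le_Lnorm_powR (f : T -> R) (q c : R) : (0 < q)%R -> (0 <= c)%R ->
  \int[P]_x (`|f x| `^ q)%:E <= (c `^ q)%:E ->
  'N[P]_q%:E[EFin \o f] <= c%:E.
Proof.
move=> q0 c0 h; rewrite unlock /=.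
have -> : c%:E = (c `^ q)%:E `^ q^-1 by rewrite poweR_EFin -powRrM divff ?gt_eqF// powRr1.
apply: gt0_ler_poweR => //.
- by rewrite invr_ge0 ltW.
- by rewrite in_itv/= leey andbT integral_ge0// => x _; exact: poweR_ge0.
- by rewrite in_itv/= leey andbT lee_fin powR_ge0.
Qed.

Lemma integral_powR_le (f : T -> R) (q c : R) : (0 < q)%R ->
  'N[P]_q%:E[EFin \o f] <= c%:E ->
  \int[P]_x (`|f x| `^ q)%:E <= (c `^ q)%:E.
Proof.
move=> q0 h.
have -> : \int[P]_x (`|f x| `^ q)%:E = 'N[P]_q%:E[EFin \o f] `^ q.
  by rewrite powR_Lnorm ?gt_eqF.
rewrite -poweR_EFin; apply: gt0_ler_poweR => //; first exact: ltW.
- by rewrite in_itv/= leey andbT Lnorm_ge0.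
- by rewrite in_itv/= leey andbT (le_trans (Lnorm_ge0 _ _ _) h).
Qed.

Lemma le_limn_einf (u : (\bar R)^nat) (l : \bar R) :
  (\forall n \near \oo, l <= u n) -> l <= limn_einf u.
Proof.
move=> [N _ hN]; rewrite limn_einf_lim; apply: lime_ge.
  exact: ereal_nondecreasing_is_cvgn (nondecreasing_einfs u).
exists N => // n /= Nn; apply: le_ereal_inf_tmp => _ [m /= nm <-].
exact/hN/(leq_trans Nn).
Qed.

Lemma limn_einf_le (u : (\bar R)^nat) (l : \bar R) :
  (\forall n \near \oo, u n <= l) -> limn_einf u <= l.
Proof.
move=> [N _ hN]; rewrite limn_einf_lim; apply: lime_le.
  exact: ereal_nondecreasing_is_cvgn (nondecreasing_einfs u).
exists N => // n /= Nn; apply: le_trans (hN n Nn).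
by apply: ereal_inf_lbound; exists n => /=.
Qed.

(** Fatou's lemma for L^q norms. The pointwise hypothesis says that [|f|] is at most the lower limit
    of [|g n|]; this one form covers sequences converging to [f], and partial sums whose limit
    merely dominates [|f|]. *)
Lemma Lnorm_fatou (f : T -> R) (g : (T -> R)^nat) (c q : R) :
  (0 < q)%R -> (0 <= c)%R -> measurable_fun [set: T] f ->
  (forall n, measurable_fun [set: T] (g n)) ->
  {ae P, forall x, forall r : R, (r < `|f x|)%R -> \forall n \near \oo, (r <= `|g n x|)%R} ->
  (\forall n \near \oo, 'N[P]_q%:E[EFin \o g n] <= c%:E) ->
  'N[P]_q%:E[EFin \o f] <= c%:E.
Proof.
move=> q0 c0 mf mg fg gc.
have mpow (h : T -> R) : measurable_fun [set: T] h ->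
    measurable_fun [set: T] (fun x => (`|h x| `^ q)%:E).
  move=> mh; apply/measurable_EFinP/(measurableT_comp (measurable_powR _)).
  exact: measurableT_comp.
apply: le_Lnorm_powR => //.
apply: (@le_trans _ _ (\int[P]_x limn_einf (fun n => (`|g n x| `^ q)%:E))).
  apply: ae_ge0_le_integral => //=.
  - exact: mpow.
  - by move=> x _; apply: le_limn_einf; apply: nearW => n; rewrite lee_fin powR_ge0.
  (* Measurability of the lower limit is read off from the upper limit of the opposite sequence. *)
  - have -> : (fun x => limn_einf (fun n => (`|g n x| `^ q)%:E)) =
        (fun x => - limn_esup (fun n => - (`|g n x| `^ q)%:E)).
      apply/funext => x; rewrite -[RHS]limn_einfN; congr limn_einf.
      by apply/funext => n; rewrite /= opprK.
    apply: measurableT_comp => //; apply: measurable_fun_limn_esup => n.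
    apply: measurableT_comp => //; exact: mpow.
  apply: filterS fg => x fgx _.
  apply/lee_addgt0Pr => e e0.
  rewrite -leeBlDr//; apply: le_limn_einf; rewrite -EFinB.
  (* The hypothesis speaks only of levels strictly below [|f x|], hence the loss of [e]: when [y] is
     nonnegative, its q-th root is such a level. *)
  set y := (_ - e)%R; have [y0|y0] := ltP y 0%R.
    by apply: nearW => n; rewrite lee_fin (le_trans (ltW y0))// powR_ge0.
  have yq : ((y `^ q^-1) `^ q = y)%R by rewrite -powRrM mulVf ?gt_eqF// powRr1.
  have : (y `^ q^-1 < `|f x|)%R.
    rewrite ltNge; apply/negP => /(ge0_ler_powR (ltW q0)).
    rewrite !nnegrE powR_ge0 normr_ge0 => /(_ isT isT); rewrite yq /y.
    by rewrite lerBrDr gerDl leNgt e0.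
  move=> /fgx; apply: filterS => n; rewrite lee_fin -{2}yq.
  by apply: (ge0_ler_powR (ltW q0)); rewrite nnegrE ?powR_ge0.
apply: (le_trans (fatou _ _ _ _)) => //.
  by move=> n; exact: mpow.
by apply: limn_einf_le; apply: filterS gc => n; exact: integral_powR_le.
Qed.

Lemma ae_Lnorm_le (f g : T -> R) (c q : R) :
  (0 < q)%R -> (0 <= c)%R -> measurable_fun [set: T] f -> measurable_fun [set: T] g ->
  {ae P, forall x, f x = g x} -> 'N[P]_q%:E[EFin \o g] <= c%:E ->
  'N[P]_q%:E[EFin \o f] <= c%:E.
Proof.
move=> q0 c0 mf mg fg gc.
apply: (@Lnorm_fatou _ (fun=> g)) => //; last exact: nearW.
by apply: filterS fg => x -> r /ltW ?; exact: nearW.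
Qed.

(** The geometric rate makes the series of [|g n - f|^2] integrable, hence finite almost everywhere,
    so its terms tend to 0 without passing to a subsequence. *)
Lemma ae_cvg_Lnorm2 (f : T -> R) (g : (T -> R)^nat) :
  measurable_fun [set: T] f -> (forall n, measurable_fun [set: T] (g n)) ->
  (forall n, 'N[P]_2%:E[EFin \o (g n \- f)%R] <= (2^-1 ^+ n)%:E) ->
  {ae P, forall x, g ^~ x @ \oo --> f x}.
Proof.
move=> mf mg gf.
pose u n x : R := (`|g n x - f x| ^+ 2)%R.
have mu n : measurable_fun [set: T] (u n).
  apply: measurable_funX; apply: measurableT_comp => //; exact: measurable_funB.
have int_u n : \int[P]_x (u n x)%:E <= (2^-1 ^+ n)%:E.
  have := @integral_powR_le (g n \- f)%R 2 (2^-1 ^+ n) (ltr0Sn _ _) (gf n).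
  have -> : (fun x => (`|(g n \- f)%R x| `^ 2)%:E) = (fun x => (u n x)%:E).
    by apply/funext => x; rewrite powR_mulrn.
  move=> /le_trans; apply; rewrite lee_fin powR_mulrn ?exprn_ge0 ?invr_ge0//.
  by rewrite expr2 ler_piMl ?exprn_ge0 ?exprn_ile1 ?invr_ge0 ?invf_le1 ?ler1n.
have mS : measurable_fun [set: T] (fun x => \sum_(0 <= n <oo) (u n x)%:E).
  apply: ge0_emeasurable_sum => [n x _ _|n _]; last exact/measurable_EFinP.
  by rewrite lee_fin sqr_ge0.
have S0 x : 0 <= \sum_(0 <= n <oo) (u n x)%:E.
  by apply: nneseries_ge0 => n _ _; rewrite lee_fin sqr_ge0.
have S_int : P.-integrable [set: T] (fun x => \sum_(0 <= n <oo) (u n x)%:E).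
  apply/integrableP; split => //.
  under eq_integral do rewrite (gee0_abs (S0 _)).
  rewrite integral_nneseries//; last 2 first.
  - by move=> n; exact/measurable_EFinP.
  - by move=> n x _; rewrite lee_fin sqr_ge0.
  apply: (@le_lt_trans _ _ (\sum_(0 <= n <oo) (2^-1 ^+ n)%:E)).
    by apply: lee_nneseries => // n _ _; apply: integral_ge0 => x _; rewrite lee_fin sqr_ge0.
  apply: le_lt_trans (ltry 2); apply: lime_le.
    by apply: is_cvg_nneseries => n _ _; rewrite lee_fin exprn_ge0 ?invr_ge0.
  apply: nearW => n; rewrite sumEFin lee_fin.
  suff -> : (\sum_(0 <= k < n) 2^-1 ^+ k = 2 - 2 * 2^-1 ^+ n :> R)%R.
    by rewrite gerBl mulr_ge0 ?exprn_ge0 ?invr_ge0.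
  elim: n => [|n IH]; first by rewrite big_geq// expr0 mulr1 subrr.
  by rewrite big_nat_recr//= IH exprS; field.
apply: filterS (integrable_ae measurableT S_int) => x /(_ I) Sx.
have : cvgn (series (u ^~ x)).
  apply: nnseries_is_cvg => [n|]; first exact: sqr_ge0.
  by rewrite -ge0_fin_numE.
move=> /cvg_series_cvg_0 ux0.
apply/cvgrPdist_lt => e e0.
move/cvgr0Pnorm_lt : ux0 => /(_ (e ^+ 2)%R (exprn_gt0 _ e0)); apply: filterS => n.
rewrite distrC ger0_norm ?sqr_ge0//.
by rewrite ltr_pXn2r// ?nnegrE// ltW.
Qed.

Lemma Lnorm_sum_le (g : (T -> R)^nat) (c : R^nat) (q : R) n :
  (1 <= q)%R -> (forall k, measurable_fun [set: T] (g k)) ->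
  (forall k, 'N[P]_q%:E[EFin \o g k] <= (c k)%:E) ->
  'N[P]_q%:E[EFin \o (fun x => \sum_(0 <= k < n) `|g k x|)%R] <= (\sum_(0 <= k < n) c k)%:E.
Proof.
move=> q1 mg gc; elim: n => [|n IH].
  under [X in Lnorm _ _ X]funext => x do rewrite /= big_geq//.
  by rewrite big_geq// Lnorm0// eqe gt_eqF// (lt_le_trans _ q1).
under [X in Lnorm _ _ X]funext => x do rewrite /= big_nat_recr//=.
rewrite big_nat_recr//= EFinD.
apply: le_trans (minkowski_EFin P _ _ q1) _.
- by apply: measurable_sum => k; exact: measurableT_comp.
- exact: measurableT_comp.
apply: leeD; first exact: IH.
by rewrite (_ : EFin \o _ = abse \o (EFin \o g n))// Lnorm_abse.
Qed.

(** Minkowski's inequality for infinitely many terms: the finite inequality bounds the partial sums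
    uniformly, and [Lnorm_fatou] passes to the limit. *)
Lemma Lnorm_series_le (f : T -> R) (g : (T -> R)^nat) (c : R^nat) (q : R) :
  (1 <= q)%R -> measurable_fun [set: T] f -> (forall k, measurable_fun [set: T] (g k)) ->
  (forall k, 'N[P]_q%:E[EFin \o g k] <= (c k)%:E) -> cvgn (series c) ->
  {ae P, forall x, cvgn (series (fun k => `|g k x|%R)) /\
     (`|f x| <= limn (series (fun k => `|g k x|)))%R} ->
  'N[P]_q%:E[EFin \o f] <= (limn (series c))%:E.
Proof.
move=> q1 mf mg gc cc fg.
have c0 k : (0 <= c k)%R by rewrite -lee_fin (le_trans (Lnorm_ge0 _ _ _) (gc k)).
have cn n := series_le_lim n c0 cc.
apply: (@Lnorm_fatou _ (fun n x => \sum_(0 <= k < n) `|g k x|)%R) => //.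
- exact: lt_le_trans q1.
- by apply: le_trans (cn 0%N); rewrite big_geq.
- by move=> n; apply: measurable_sum => k; exact: measurableT_comp.
- apply: filterS fg => x [cx fx] r rf.
  apply: (filterS _ (@cvgr_gt _ _ _ _ _ _ cx r (lt_le_trans rf fx))) => n /ltW rn.
  by rewrite ger0_norm ?sumr_ge0// -seriesEnat.
- by apply: nearW => n; apply: le_trans (Lnorm_sum_le n q1 mg gc) _; rewrite lee_fin.
Qed.

End LpConvergence.

(** * Inner products and orthogonal projections *)

Section InnerProduct.
Context {R : realType} {V : normedModType R}.

(** The last field is the only link with the topology: it makes [hnorm] balls neighbourhoods, so
    that dense sets can be approached in [hnorm]. It holds for the maximum norm on a product, where
    equality of the norms fails. *)
Record inner_product (ip : V -> V -> R) : Prop := InnerProduct {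
  ip_sym : forall x y, ip x y = ip y x;
  ip_linear : forall (a : R) x y z, ip (a *: x + y) z = a * ip x z + ip y z;
  ip_ge0 : forall x, 0 <= ip x x;
  ip_eq0 : forall x, ip x x = 0 -> x = 0;
  hnorm_bounded : exists2 C : R, 0 < C & forall x, hnorm ip x <= C * `|x| }.

Variable ip : V -> V -> R.
Hypothesis ipP : inner_product ip.

Lemma ipDl x y z : ip (x + y) z = ip x z + ip y z.
Proof. by rewrite -[x in LHS]scale1r (ip_linear ipP) mul1r. Qed.

Lemma ip0l z : ip 0 z = 0.
Proof. by apply: (addIr (ip 0 z)); rewrite -ipDl !add0r. Qed.

Lemma ipZl a x z : ip (a *: x) z = a * ip x z.
Proof. by rewrite -[_ *: x]addr0 (ip_linear ipP) ip0l addr0. Qed.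

Lemma ipNl x z : ip (- x) z = - ip x z.
Proof. by rewrite -scaleN1r ipZl mulN1r. Qed.

Lemma ipBl x y z : ip (x - y) z = ip x z - ip y z.
Proof. by rewrite ipDl ipNl. Qed.

Lemma ipDr x y z : ip z (x + y) = ip z x + ip z y.
Proof. by rewrite !(ip_sym ipP z) ipDl. Qed.

Lemma ipZr a x z : ip z (a *: x) = a * ip z x.
Proof. by rewrite !(ip_sym ipP z) ipZl. Qed.

Lemma ipBr x y z : ip z (x - y) = ip z x - ip z y.
Proof. by rewrite !(ip_sym ipP z) ipBl. Qed.

Lemma ip_suml I (s : seq I) (Q : pred I) (f : I -> V) z :
  ip (\sum_(k <- s | Q k) f k) z = \sum_(k <- s | Q k) ip (f k) z.
Proof. by apply: (big_morph (ip^~ z)) => [x y|]; rewrite ?ipDl ?ip0l. Qed.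

Lemma ip_sumr I (s : seq I) (Q : pred I) (f : I -> V) z :
  ip z (\sum_(k <- s | Q k) f k) = \sum_(k <- s | Q k) ip z (f k).
Proof. by rewrite (ip_sym ipP) ip_suml; apply: eq_bigr => k _; rewrite (ip_sym ipP). Qed.

Lemma sqr_hnorm x : hnorm ip x ^+ 2 = ip x x.
Proof. by rewrite sqr_sqrtr ?ip_ge0. Qed.

Lemma hnorm_ge0 x : 0 <= hnorm ip x. Proof. exact: sqrtr_ge0. Qed.

Lemma hnormZ a x : hnorm ip (a *: x) = `|a| * hnorm ip x.
Proof. by rewrite /hnorm ipZl ipZr mulrA -expr2 sqrtrM ?sqr_ge0// sqrtr_sqr. Qed.

Lemma hnormBC x y : hnorm ip (x - y) = hnorm ip (y - x).
Proof. by rewrite -opprB -scaleN1r hnormZ normrN1 mul1r. Qed.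

Lemma hnorm_eq0 x : hnorm ip x = 0 -> x = 0.
Proof. by move=> x0; apply: (ip_eq0 ipP); rewrite -sqr_hnorm x0 expr0n. Qed.

(** Cauchy-Schwarz, from positivity of the form at [|y|^2] times the component of [x] orthogonal to
    [y]. *)
Lemma ip_le_hnorm x y : `|ip x y| <= hnorm ip x * hnorm ip y.
Proof.
have [/hnorm_eq0 ->|y0] := eqVneq (hnorm ip y) 0.
  by rewrite (ip_sym ipP) ip0l normr0 mulr_ge0 ?hnorm_ge0.
have {}y0 : 0 < hnorm ip y by rewrite lt0r y0 hnorm_ge0.
rewrite -ler_sqr ?nnegrE ?mulr_ge0 ?hnorm_ge0// exprMn real_normK ?num_real//.
have := ip_ge0 ipP (hnorm ip y ^+ 2 *: x - ip x y *: y).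
rewrite ipBl !ipBr !ipZl !ipZr (ip_sym ipP y x) -!sqr_hnorm.
set n := hnorm ip y in y0 *; set m := hnorm ip x; set p := ip x y.
rewrite [X in 0 <= X -> _](_ : _ = n ^+ 2 * (m ^+ 2 * n ^+ 2 - p ^+ 2)); last by ring.
by rewrite pmulr_rge0 ?exprn_gt0// subr_ge0.
Qed.

Lemma ler_hnormD x y : hnorm ip (x + y) <= hnorm ip x + hnorm ip y.
Proof.
rewrite -ler_sqr ?nnegrE ?addr_ge0 ?hnorm_ge0//.
rewrite sqr_hnorm ipDl !ipDr sqrrD !sqr_hnorm (ip_sym ipP y x).
have := le_trans (ler_norm _) (ip_le_hnorm x y); lra.
Qed.

Lemma ler_hnorm_sum I (s : seq I) (f : I -> V) :
  hnorm ip (\sum_(k <- s) f k) <= \sum_(k <- s) hnorm ip (f k).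
Proof.
elim: s => [|k s IH]; last by rewrite !big_cons (le_trans (ler_hnormD _ _))// lerD2l.
by rewrite !big_nil /hnorm ip0l sqrtr0.
Qed.

Section Projection.
Variables (E : set V) (n : nat) (w : 'I_n -> V).
Hypothesis wE : orthonormal_basis ip E w.

Let p x := \sum_(j < n) ip x (w j) *: w j.

Let p_in x : E (p x).
Proof. by case: wE => _ <-; exists (index_enum 'I_n), (fun j => ip x (w j)). Qed.

Let p_orth x z : E z -> ip (x - p x) z = 0.
Proof.
case: wE => ow <- [s [c ->]]; rewrite ip_sumr big1// => k _.
rewrite ipZr ipBl ip_suml (bigD1 k)//= big1 => [|j jk]; last first.
  by rewrite ipZl ow (negbTE jk) mulr0.
by rewrite ipZl ow eqxx mulr1 addr0 subrr mulr0.
Qed.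

(** [orthoproj] is defined by choice, so the explicit formula rests on uniqueness: the difference of
    two candidates lies in [E] and is orthogonal to [E], hence to itself. *)
Lemma orthoprojE x : orthoproj ip E x = p x.
Proof.
apply: xget_unique => [|y [Ey oy]]; first by split; [exact: p_in|exact: p_orth].
have /eqP : p x - y = 0.
  apply: (ip_eq0 ipP).
  have {1}-> : p x - y = (x - y) - (x - p x) by rewrite opprB [RHS]addrC addrA subrK.
  by rewrite ipBl !ipBr !(oy _ (p_in x), oy _ Ey, p_orth x (p_in x), p_orth x Ey) !subrr.
by rewrite subr_eq0 => /eqP.
Qed.

(** Pythagoras, the residual being orthogonal to [p x - z]. *)
Lemma orthoproj_le x z : E z -> hnorm ip (x - orthoproj ip E x) <= hnorm ip (x - z).
Proof.
move=> Ez; rewrite orthoprojE -ler_sqr ?nnegrE ?hnorm_ge0// !sqr_hnorm.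
have -> : x - z = (x - p x) + (p x - z) by rewrite addrA subrK.
have : ip (x - p x) (p x - z) = 0.
  by rewrite ipBr (p_orth x (p_in x)) (p_orth x Ez) subrr.
move: (x - p x) (p x - z) => u v uv.
by rewrite ipDl !ipDr (ip_sym ipP v u) uv addr0 add0r lerDl ip_ge0.
Qed.

End Projection.

End InnerProduct.

(** * Continuous functionals under the Wiener measure *)

(** The change of variables is available for the Radon-Nikodym derivative; that derivative agrees
    almost everywhere with [normal_pdf], since both have the same integral over every measurable
    set. *)
Lemma ge0_integral_normal_prob {R : realType} (m s : R) (f : R -> \bar R) :
  (forall x, 0 <= f x)%E -> measurable_fun [set: R] f ->
  (\int[normal_prob m s]_x f x =
   \int[lebesgue_measure]_x (f x * (normal_pdf m s x)%:E))%E.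
Proof.
move=> f0 mf.
have dom := @normal_prob_dominates R m s.
rewrite -(Radon_Nikodym_SigmaFinite.change_of_variables dom)//.
have mRN : measurable_fun [set: R]
    (Radon_Nikodym_SigmaFinite.f (normal_prob m s) (@lebesgue_measure R)).
  exact: measurable_int (Radon_Nikodym_SigmaFinite.f_integrable dom).
have mpdf : measurable_fun [set: R] (EFin \o normal_pdf m s).
  by apply/measurable_EFinP; exact: measurable_normal_pdf.
apply: ae_eq_integral => //; try exact: emeasurable_funM.
apply: ae_eqe_mul2l.
apply: integral_ae_eq => //.
- exact: Radon_Nikodym_SigmaFinite.f_integrable.
- by move=> A _ mA; rewrite -Radon_Nikodym_SigmaFinite.f_integral.
Qed.

Section Borel.
Context {R : realType} {W : normedModType R}.

Lemma continuous_borel_measurable (f : W -> R) : continuous f ->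
  measurable_fun [set: borel W] (f : borel W -> R).
Proof.
move=> cf; apply: (measurability _ (RGenOInfty.measurableE R)) => _ [_ [x ->] <-].
rewrite setTI; apply: sub_sigma_algebra => /=.
by apply: open_comp => [y _|]; [exact: cf|rewrite set_itvE; exact: open_gt].
Qed.

End Borel.

Section DualFunctionals.
Context {R : realType} {V W : normedModType R} (ip : V -> V -> R) (i : V -> W).
Hypothesis ipP : inner_product ip.

Lemma dual_repr_linear (f g : {linear W -> R^o}) (a b : V) (c : R) :
  dual_repr ip i f a -> dual_repr ip i g b ->
  exists k : {linear W -> R^o}, dual_repr ip i k (c *: a + b) /\
    forall x, k x = c * f x + g x.
Proof.
move=> [cf fa] [cg gb].
have kE : linear (fun x => c *: f x + g x : R^o).
  move=> t x y; rewrite !linearP/=; rewrite /GRing.scale/=; ring.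
pose k : {linear W -> R^o} := HB.pack (fun x => c *: f x + g x : R^o)
  (GRing.isLinear.Build _ _ _ _ _ kE).
exists k; split=> [|//]; split.
  move=> x; apply: (@cvgD _ R^o _ _ _ (fun x => c *: f x) g); last exact: cg.
  by apply: (@cvgZr _ R^o); exact: cf.
by move=> x; rewrite /= fa gb (ipDl ipP) (ipZl ipP).
Qed.

Lemma dual_repr_zero :
  exists k : {linear W -> R^o}, dual_repr ip i k 0 /\ forall x, k x = 0.
Proof.
have kE : linear (fun _ : W => 0 : R^o) by move=> t x y; rewrite scaler0 addr0.
pose k : {linear W -> R^o} := HB.pack (fun _ : W => 0 : R^o)
  (GRing.isLinear.Build _ _ _ _ _ kE).
exists k; split=> [|//]; split=> x; first exact: cst_continuous.
by rewrite (ip0l ipP).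
Qed.

Lemma dual_repr_sum (I : Type) (s : seq I) (f : I -> {linear W -> R^o}) (a : I -> V) (c : I -> R) :
  (forall k, dual_repr ip i (f k) (a k)) ->
  exists k : {linear W -> R^o}, dual_repr ip i k (\sum_(j <- s) c j *: a j) /\
    forall x, k x = \sum_(j <- s) c j * f j x.
Proof.
move=> fa; elim: s => [|j s [k [ka kE]]].
  have [k [k0 kE]] := dual_repr_zero.
  by exists k; rewrite big_nil; split=> // x; rewrite big_nil kE.
have [k' [k'a k'E]] := dual_repr_linear (c j) (fa j) ka.
by exists k'; rewrite big_cons; split=> // x; rewrite big_cons k'E kE.
Qed.

(** The open set where [f] is nonzero would otherwise meet the dense range of [i], on which [f]
    vanishes. This settles the degenerate case of variance 0. *)
Lemma dual_repr0 (f : {linear W -> R^o}) : dense (range i) ->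
  dual_repr ip i f 0 -> forall x, f x = 0.
Proof.
move=> di [cf f0] x; apply/eqP; rewrite -[_ == _]negbK; apply/negP => fx.
have [y [/= fy [v _ iv]]] : [set y : W | f y != 0] `&` range i !=set0.
  apply: di; first by exists x.
  apply: (@open_comp _ _ f [set t | t != 0]) => [y _|]; first exact: cf.
  exact: open_neq.
by move: fy; rewrite -iv f0 (ip0l ipP) eqxx.
Qed.

Context (h : R) (P : probability (borel W) R).
Hypotheses (h0 : 0 < h) (PW : wiener_measure ip i h P).

(** The case [n = 1] of [wiener_measure]: a unit vector alone is an orthonormal family. *)
Lemma wiener_law (f : {linear W -> R^o}) (a : V) (A : set R) :
  dual_repr ip i f a -> hnorm ip a = 1 -> measurable A ->
  P ((f : borel W -> R) @^-1` A) = normal_prob 0 (Num.sqrt h) A.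
Proof.
move=> fa a1 mA.
have oa : orthonormal_family ip (fun _ : 'I_1 => a).
  by move=> j k; rewrite !ord1 eqxx -sqr_hnorm// a1 expr1n.
have mA' : measurable [set v : 1.-tuple R | A (tnth v ord0)].
  rewrite -[X in measurable X]setTI.
  by apply: (measurable_tnth ord0 (T := R)).
have := PW oa (fun _ => fa) mA'.
have -> : [set x | [set v : 1.-tuple R | A (tnth v ord0)] [tuple f x | j < 1]] =
    (f : borel W -> R) @^-1` A.
  by apply/seteqP; split => x /=; rewrite tnth_mktuple.
move=> ->; rewrite /gaussian_tuple /= /normal_prob [RHS]integral_mkcond.
apply: eq_integral => x _; rewrite patchE /gaussian_density big_ord_recl big_ord0.
rewrite addr0 indicE (_ : tnth _ ord0 = x)//.
have -> : ([tuple of x :: [tuple]] \in [set v : 1.-tuple R | A (tnth v ord0)]) = (x \in A).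
  by apply/idP/idP; rewrite !inE.
case: ifPn => xA /=; last by rewrite mulr0.
by rewrite mulr1 normal_pdf_sqrt// mulrAC mul1r.
Qed.

(** After normalisation of [a] the law is normal of variance [h], and the norm of [a] factors out.
    When [a = 0] no normalisation is possible, but then [f] vanishes identically. *)
Lemma wiener_Lnorm (f : {linear W -> R^o}) (a : V) (q : R) : 1 <= q ->
  dense (range i) -> dual_repr ip i f a ->
  ('N[P]_q%:E[EFin \o (f : borel W -> R)] <=
     (Kconst q * h `^ (1 / 2) * hnorm ip a)%:E)%E.
Proof.
move=> q1 di fa.
have [a0|a0] := eqVneq (hnorm ip a) 0.
  rewrite a0 mulr0.
  have -> : EFin \o (f : borel W -> R) = cst 0%E.
    by apply/funext => x /=; rewrite (dual_repr0 di)// -(hnorm_eq0 ipP a0).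
  by rewrite Lnorm0// eqe gt_eqF// (lt_le_trans _ q1).
have {}a0 : 0 < hnorm ip a by rewrite lt0r a0 hnorm_ge0.
have q0 : 0 < q by exact: lt_le_trans q1.
have Kh0 := Kconst_powR_ge0 h q.
(* A sum with a single term serves to divide [f] by the norm of [a]. *)
have [k [ka kE]] := dual_repr_sum [:: tt] (fun _ => (hnorm ip a)^-1) (fun _ => fa).
rewrite big_seq1 in ka.
have {kE}fk x : f x = hnorm ip a * k x by rewrite kE big_seq1 mulVKf// gt_eqF.
have a1 : hnorm ip ((hnorm ip a)^-1 *: a) = 1.
  by rewrite hnormZ// ger0_norm ?invr_ge0 ?hnorm_ge0// mulVf// gt_eqF.
have mk : measurable_fun [set: borel W] (k : borel W -> R).
  by apply: continuous_borel_measurable; case: ka.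
have mf : measurable_fun [set: borel W] (f : borel W -> R).
  by apply: continuous_borel_measurable; case: fa.
have mpow : measurable_fun [set: R] (fun t : R => (`|t| `^ q)%:E).
  apply/measurable_EFinP; apply: (measurableT_comp (measurable_powR _)).
  exact: normr_measurable.
have intk : (\int[P]_x (`|k x| `^ q)%:E <= ((Kconst q * h `^ (1 / 2)) `^ q)%:E)%E.
  apply: le_trans (integral_powR_normal_pdf h0 q1).
  under [leRHS]eq_integral do rewrite EFinM.
  rewrite -(ge0_integral_normal_prob 0 (Num.sqrt h) _ mpow); last first.
    by move=> t; rewrite lee_fin powR_ge0.
  rewrite (@eq_measure_integral _ (measurableTypeR R) R _
    (pushforward P (k : borel W -> measurableTypeR R))); last first.
    by move=> A mA _; exact: esym (wiener_law ka a1 mA).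
  by rewrite ge0_integral_pushforward.
apply: le_Lnorm_powR => //; first by rewrite mulr_ge0 ?hnorm_ge0.
rewrite powRM ?hnorm_ge0//.
under eq_integral do rewrite fk normrM powRM// (ger0_norm (hnorm_ge0 _ _)) mulrC EFinM.
rewrite ge0_integralZr//=; last 2 first.
- exact: (measurableT_comp mpow mk).
- by rewrite lee_fin powR_ge0.
by rewrite EFinM lee_wpmul2r// lee_fin powR_ge0.
Qed.

End DualFunctionals.

(** * Gaussian bounds for combinations of [ell] *)

Section EllCombinations.
Context {R : realType} {V W : normedModType R} (ip : V -> V -> R) (i : V -> W).
Hypothesis ipP : inner_product ip.
Context (h : R) (P : probability (borel W) R) (ell : V -> W -> R).
Hypotheses (h0 : 0 < h) (PW : wiener_measure ip i h P).
Hypotheses (ellP : is_ell ip i P ell) (di : dense (range i)).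
Hypothesis dense_dual : dense [set a | in_dual ip i a].

Lemma measurable_ell a : measurable_fun [set: borel W] (ell a : borel W -> R).
Proof. by case: ellP => /(_ a) + _ _; rewrite inE/= => /andP[]; rewrite !inE. Qed.

(** Elements of the dual are dense and [ell] is continuous in L^2 at [a]; on the dual, [ell b] is
    almost everywhere a continuous functional. *)
Lemma ell_approx (a : V) (e : R) : 0 < e ->
  exists b (f : {linear W -> R^o}), [/\ dual_repr ip i f b, hnorm ip (b - a) <= e &
    ('N[P]_2%:E[EFin \o (fun x : borel W => f x - ell a x)%R] <= e%:E)%E].
Proof.
move=> e0; case: ellP => _ ell_dual /(_ a) ell_cvg.
have [C C0 hC] := hnorm_bounded ipP.
have near1 : \forall b \near a,
    (Lnorm P 2%:E (fun x : borel W => (ell b x - ell a x)%:E) < e%:E)%E.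
  have := ell_cvg [set t | (t < e%:E)%E]; apply.
  by apply: open_nbhs_nbhs; split; [exact: open_ereal_lt_ereal|rewrite /= lte_fin].
have near2 : \forall b \near a, hnorm ip (b - a) < e.
  near=> b; apply: le_lt_trans (hC _) _.
  rewrite mulrC -ltr_pdivlMr// distrC.
  near: b; apply: cvgr_dist_lt; [exact: cvg_id|exact: divr_gt0].
have near12 := filterI near1 near2.
have [b [/interior_subset[/= b1 b2] [f fb]]] :
    interior [set b | (Lnorm P 2%:E (fun x : borel W => (ell b x - ell a x)%:E) < e%:E)%E /\
                      hnorm ip (b - a) < e] `&` [set b | in_dual ip i b] !=set0.
  apply: dense_dual; last exact: open_interior.
  by exists a; exact: (near12 _).
exists b, f; split => //; first exact: ltW.
have mf : measurable_fun [set: borel W] (f : borel W -> R).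
  by apply: continuous_borel_measurable; case: fb.
have mba : measurable_fun [set: borel W] (fun x : borel W => ell b x - ell a x).
  by apply: measurable_funB; exact: measurable_ell.
have bf : {ae P, forall x : borel W, ell b x = f x} := ell_dual _ _ fb.
apply: (@ae_Lnorm_le _ _ _ P _ (fun x => ell b x - ell a x)) => //; last exact: ltW.
- exact: ltW.
- by apply: measurable_funB => //; exact: measurable_ell.
- by apply: filterS bf => x ->.
Unshelve. all: by end_near. Qed.

(** [is_ell] has no linearity clause, so linearity is borrowed from functionals: replacing each
    [w j] by a dual element [b (j, m)] at distance [2^-m] turns the combination into one functional,
    bounded by [wiener_Lnorm]. The replacements converge almost everywhere, and Fatou's lemma yields
    the bound for any [q]. *)
Lemma ell_sum_Lnorm (q : R) (I : finType) (c : I -> R) (w : I -> V) : 1 <= q ->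
  ('N[P]_q%:E[EFin \o (fun x : borel W => \sum_j c j * ell (w j) x)%R] <=
   (Kconst q * h `^ (1 / 2) * hnorm ip (\sum_j c j *: w j))%:E)%E.
Proof.
move=> q1.
have q0 : 0 < q by exact: lt_le_trans q1.
have e0 m : 0 < 2^-1 ^+ m :> R by rewrite exprn_gt0 ?invr_gt0.
have /choice[b bP] : forall jm : I * nat, exists b, exists f : {linear W -> R^o},
  [/\ dual_repr ip i f b, hnorm ip (b - w jm.1) <= 2^-1 ^+ jm.2 &
    ('N[P]_2%:E[EFin \o (fun x : borel W => f x - ell (w jm.1) x)%R] <= (2^-1 ^+ jm.2)%:E)%E].
  by move=> [j m]; exact: ell_approx.
have {bP} /choice[f fP] := bP.
have mf j m : measurable_fun [set: borel W] (f (j, m) : borel W -> R).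
  by apply: continuous_borel_measurable; case: (fP (j, m)) => -[].
have K0 := Kconst_powR_ge0 h q.
set K := Kconst q * _ in K0 *; set v := \sum_j c j *: w j.
(* [s * 2^-m] is the error made by replacing each [w j] by [b (j, m)]; it falls below [e] for large
   [m]. *)
pose s := K * \sum_j `|c j|.
have s0 : 0 <= s by rewrite mulr_ge0// sumr_ge0.
apply/lee_addgt0Pr => e eps0; rewrite -EFinD.
apply: (@Lnorm_fatou _ _ _ P _ (fun m x => \sum_j c j * f (j, m) x)) => //.
- by apply: addr_ge0 (ltW eps0); apply: mulr_ge0 => //; exact: hnorm_ge0.
- by apply: measurable_sum => j; apply: measurable_funM => //; exact: measurable_ell.
- by move=> m; apply: measurable_sum => j; apply: measurable_funM.
- have ae_cvg j : {ae P, forall x, f (j, m) x @[m --> \oo] --> ell (w j) x}.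
    apply: (ae_cvg_Lnorm2 (g := fun m => f (j, m) : borel W -> R)) => //.
      exact: measurable_ell.
    by move=> m; case: (fP (j, m)).
  have ae_cvgs : {ae P, forall x : borel W, forall j, f (j, m) x @[m --> \oo] --> ell (w j) x}.
    exact: filter_forall ae_cvg.
  apply: filterS ae_cvgs => x fx r rx.
  have cvg_sum : `|\sum_j c j * f (j, m) x| @[m --> \oo] --> `|\sum_j c j * ell (w j) x|.
    apply: cvg_norm; apply: cvg_big => [|j _]; first exact: add_continuous.
    by apply: cvgMr; exact: fx.
  by apply: filterS (@cvgr_gt _ _ _ _ _ _ cvg_sum r rx) => m /ltW.
near=> m.
have fb j : dual_repr ip i (f (j, m)) (b (j, m)) by case: (fP (j, m)).
have [k [ka kE]] := dual_repr_sum ipP (index_enum I) c fb.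
have -> : (fun x : borel W => \sum_j c j * f (j, m) x) = (k : borel W -> R).
  by apply/funext => x; rewrite kE.
apply: le_trans (wiener_Lnorm ipP h0 PW q1 di ka) _.
rewrite lee_fin -/K.
have : hnorm ip (\sum_j c j *: b (j, m)) <= hnorm ip v + (\sum_j `|c j|) * 2^-1 ^+ m.
  have -> : \sum_j c j *: b (j, m) = v + \sum_j c j *: (b (j, m) - w j).
    by rewrite -big_split/=; apply: eq_bigr => j _; rewrite scalerBr [RHS]addrC subrK.
  apply: le_trans (ler_hnormD ipP _ _) _; rewrite lerD2l.
  apply: le_trans (ler_hnorm_sum ipP _ _) _; rewrite mulr_suml.
  apply: ler_sum => j _; rewrite (hnormZ ipP) ler_wpM2l//.
  by case: (fP (j, m)).
move=> /(ler_wpM2l K0) /le_trans; apply; rewrite mulrDr lerD2l mulrA -/s.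
near: m.
have := @cvg_geometric R s 2^-1.
rewrite ger0_norm ?invr_ge0// invf_lt1// ltr1n => /(_ isT) s_cvg.
by apply: filterS (@cvgr_lt _ _ _ _ _ _ s_cvg e eps0) => m /ltW.
Unshelve. all: by end_near. Qed.

End EllCombinations.

(** * Measurability of functions of finitely many variables *)

Section MeasurableCombinations.
Context {R : realType} {V : normedModType R}.
Context d (X : measurableType d) (n : nat).

(** The coordinates [t j] are merely measurable, so the continuity of [g] is exploited in the
    coordinate space, where the open condition [r < g] is exhausted by countably many cubes. *)
Lemma measurable_continuous_sum (g : V -> R) (t : 'I_n -> X -> R) (w : 'I_n -> V) :
  continuous g -> (forall j, measurable_fun [set: X] (t j)) ->
  measurable_fun [set: X] (fun x => g (\sum_j t j x *: w j)).
Proof.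
move=> cg mt; apply: (measurability _ (RGenOInfty.measurableE R)) => _ [_ [r ->] <-].
rewrite setTI.
(* cubes with rational centre and side 2 / (k + 1) on which g stays above r *)
pose cube (qk : {ffun 'I_n -> rat} * nat) : set ('I_n -> R) :=
  [set s | forall j, `|s j - ratr (qk.1 j)| < qk.2.+1%:R^-1].
pose good qk := forall s, cube qk s -> r < g (\sum_j s j *: w j).
have -> : (fun x => g (\sum_j t j x *: w j)) @^-1` `]r, +oo[%classic =
    \bigcup_qk [set x | good qk /\ cube qk (t ^~ x)].
  apply/seteqP; split=> [x|x [qk _ [gqk cx]]]; last first.
    by rewrite /= in_itv/= andbT; exact: gqk.
  rewrite /= in_itv/= andbT => rg.
  have [e e0 He] : exists2 e : R, 0 < e & forall v, `|\sum_j t j x *: w j - v| < e -> r < g v.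
    have : \forall v \near (\sum_j t j x *: w j), r < g v.
      by apply: (@cvgr_gt _ _ _ _ _ _ (cg _)).
    by move=> /nbhs_ballP[e e0 He]; exists e => // v ve; apply: He; rewrite -ball_normE.
  (* Two points of a cube differ by less than [2 / (k + 1)] in each coordinate, so their images
     differ by less than [2 M / (k + 1)]. The summand 1 keeps [M] positive when every [w j] is 0. *)
  pose M : R := 1 + \sum_j `|w j|.
  have M0 : 0 < M by rewrite ltr_wpDr// sumr_ge0.
  pose k := Num.truncn (2 * M / e).
  have ke : k.+1%:R^-1 < e / (2 * M).
    rewrite -[ltRHS]invf_div ltf_pV2 ?posrE ?divr_gt0 ?mulr_gt0//; exact: truncnS_gt.
  have k0 : 0 < k.+1%:R^-1 :> R by rewrite invr_gt0.
  have /choice[q Hq] : forall j, exists q : rat, `|t j x - ratr q| < k.+1%:R^-1.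
    move=> j; have [|q] := @rat_in_itvoo R (t j x - k.+1%:R^-1) (t j x + k.+1%:R^-1).
      by rewrite ltrD2l gtrN.
    by rewrite in_itv/= => /andP[q1 q2]; exists q; rewrite ltr_distlC q1 q2.
  exists ([ffun j => q j], k) => //; split=> [s cs|j]; last by rewrite /= ffunE.
  apply: He; rewrite -sumrB; apply: le_lt_trans (ler_norm_sum _ _ _) _.
  apply: (@le_lt_trans _ _ (\sum_j (2 * k.+1%:R^-1) * `|w j|)).
    apply: ler_sum => j _; rewrite -scalerBl normrZ ler_wpM2r//.
    have := cs j; rewrite /= ffunE => sj.
    rewrite -[X in X - _](subrK (ratr (q j))) -addrA; apply: le_trans (ler_normD _ _) _.
    rewrite mulr_natl mulr2n lerD ?ltW//.
    by rewrite distrC.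
  rewrite -mulr_sumr; apply: (@le_lt_trans _ _ (2 * k.+1%:R^-1 * M)).
    by rewrite ler_wpM2l ?mulr_ge0 ?(ltW k0)// lerDr.
  by move: ke; rewrite ltr_pdivlMr ?mulr_gt0// mulrCA mulrA.
apply: countable_bigcupT_measurable => [|qk]; first exact: countableP.
have [gqk|gqk] := pselect (good qk); last first.
  rewrite (_ : [set x | _] = set0)//.
  by apply/seteqP; split => [x []|].
rewrite (_ : [set x | _] =
  \bigcap_(j in [set: 'I_n]) (t j @^-1`
    `](ratr (qk.1 j) - qk.2.+1%:R^-1), (ratr (qk.1 j) + qk.2.+1%:R^-1)[%classic)).
  apply: fin_bigcap_measurable => // j _; rewrite -[X in measurable X]setTI.
  exact: mt.
apply/seteqP; split=> [x [_ cx] j _|x cx].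
  by rewrite /= in_itv/= -ltr_distl; exact: cx.
by split=> // j; rewrite ltr_distl; have := cx j I; rewrite /= in_itv.
Qed.

End MeasurableCombinations.

(** * The modulus against real and imaginary parts *)

Section ComplexModulus.
Context {R : realType}.
Implicit Types z : R[i].

Lemma modulusE z : modulus z = Num.sqrt (complex.Re z ^+ 2 + complex.Im z ^+ 2).
Proof. by case: z. Qed.

Lemma modulus_ge0 z : 0 <= modulus z.
Proof. by rewrite modulusE sqrtr_ge0. Qed.

Lemma modulusD z1 z2 : modulus (z1 + z2) <= modulus z1 + modulus z2.
Proof. exact: le_normcD. Qed.

Lemma modulusBC z1 z2 : modulus (z1 - z2) = modulus (z2 - z1).
Proof. by rewrite -opprB normcN. Qed.

Lemma Re_le_modulus z : `|complex.Re z| <= modulus z.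
Proof. by rewrite modulusE -sqrtr_sqr ler_wsqrtr// lerDl sqr_ge0. Qed.

Lemma Im_le_modulus z : `|complex.Im z| <= modulus z.
Proof. by rewrite modulusE -sqrtr_sqr ler_wsqrtr// lerDr sqr_ge0. Qed.

Lemma modulus_le_ReIm z : modulus z <= `|complex.Re z| + `|complex.Im z|.
Proof.
rewrite modulusE -[leRHS]ger0_norm ?addr_ge0// -sqrtr_sqr ler_wsqrtr//.
rewrite sqrrD !real_normK ?num_real// lerD2r lerDl mulrn_wge0 ?mulr_ge0//.
Qed.

Lemma ReB z1 z2 : complex.Re (z1 - z2) = complex.Re z1 - complex.Re z2.
Proof. by case: z1 z2 => ? ? []. Qed.

Lemma ImB z1 z2 : complex.Im (z1 - z2) = complex.Im z1 - complex.Im z2.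
Proof. by case: z1 z2 => ? ? []. Qed.

Lemma ReIm_CauchySchwarz z1 z2 :
  complex.Re z1 * complex.Re z2 + complex.Im z1 * complex.Im z2 <= modulus z1 * modulus z2.
Proof.
rewrite !modulusE; move: (complex.Re z1) (complex.Im z1) (complex.Re z2) (complex.Im z2) => a b c e.
rewrite -sqrtrM ?addr_ge0 ?sqr_ge0//; apply: le_trans (ler_norm _) _.
rewrite -sqrtr_sqr ler_wsqrtr// -subr_ge0.
(* Lagrange's identity in two dimensions. *)
rewrite (_ : _ - _ = (a * e - b * c) ^+ 2) ?sqr_ge0//; ring.
Qed.

End ComplexModulus.

(** * The weighted Lipschitz estimate *)

Section Lipschitz.
Context {R : realType} {V : normedModType R}.

Lemma is_derive_line (f : V -> R) (x v : V) (s : R) :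
  derivable (f : V -> R^o) (s *: v + x) v ->
  is_derive s (1 : R) (fun t : R => f (t *: v + x) : R^o) ('D_v (f : V -> R^o) (s *: v + x)).
Proof.
move=> df.
have E : (fun h : R => h^-1 *:
      (((fun t : R => f (t *: v + x) : R^o) \o shift s) (h *: 1) - f (s *: v + x))) =
    (fun h : R => h^-1 *: (((f : V -> R^o) \o shift (s *: v + x)) (h *: v) - f (s *: v + x))).
  by apply/funext => h /=; rewrite scalerDl addrA [h *: 1]mulr1.
by split; rewrite /derivable /derive E.
Qed.

(** The mean value theorem fails for complex values, and treating the two parts separately would
    spoil the constant. With [z] the total increment, it is applied to the real function [g], the
    real part of [conj z * F] along the line: [|z|^2 = g t - g 0 <= |z| L t]. *)
Lemma directional_lipschitz (F : V -> R[i]) (v : V) (L : R) :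
  (forall x, cderivable F x v) -> (forall x, modulus (cderive F v x) <= L) ->
  forall x (t : R), modulus (F (t *: v + x) - F x) <= L * `|t|.
Proof.
move=> dF FL.
have L0 : 0 <= L by apply: le_trans (FL 0); exact: modulus_ge0.
suff pos x t : 0 <= t -> modulus (F (t *: v + x) - F x) <= L * t.
  move=> x t; have [t0|t0] := leP 0 t; first by rewrite ger0_norm// pos.
  rewrite modulusBC ltr0_norm//.
  have := pos (t *: v + x) (- t); rewrite scaleNr addKr; apply.
  by rewrite oppr_ge0 ltW.
move=> t0.
pose z := F (t *: v + x) - F x.
pose g (s : R) : R := complex.Re z * complex.Re (F (s *: v + x)) +
  complex.Im z * complex.Im (F (s *: v + x)).
pose dg (s : R) : R := complex.Re z * complex.Re (cderive F v (s *: v + x)) +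
  complex.Im z * complex.Im (cderive F v (s *: v + x)).
have gd s : is_derive s (1 : R) (g : R -> R^o) (dg s).
  have [dR dI] := dF (s *: v + x).
  have iR := is_derive_line dR; have iI := is_derive_line dI.
  exact: (is_deriveD (is_deriveZ _ _) (is_deriveZ _ _)).
have [|c _] := @MVT_segment R g dg 0 t t0 (fun s _ => gd s).
  apply: derivable_within_continuous => s _; exact: ex_derive.
rewrite subr0 => gt.
have zz : modulus z ^+ 2 = g t - g 0.
  rewrite modulusE sqr_sqrtr ?addr_ge0 ?sqr_ge0// /g scale0r add0r.
  rewrite !expr2 /z ReB ImB; ring.
have [z0|z0] := eqVneq (modulus z) 0; first by rewrite -/z z0 mulr_ge0.
have {}z0 : 0 < modulus z by rewrite lt0r z0 modulus_ge0.
rewrite -(ler_pM2l z0) -expr2 zz gt mulrA ler_wpM2r//.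
apply: le_trans (ReIm_CauchySchwarz _ _) _.
by rewrite ler_wpM2l// modulus_ge0.
Qed.

Variable ip : V -> V -> R.
Hypothesis ipP : inner_product ip.
Variable b : nat -> V.
Hypothesis b_orth : forall j k, j != k -> ip (b j) (b k) = 0.
Hypothesis b_unit : forall k, b k = 0 \/ ip (b k) (b k) = 1.

Lemma ip_b_scale k : ip (b k) (b k) *: b k = b k.
Proof. by case: (b_unit k) => [->|->]; rewrite ?scaler0 ?scale1r. Qed.

Lemma ip_b_le k x : `|ip (b k) x| <= hnorm ip x.
Proof.
apply: le_trans (ip_le_hnorm ipP _ _) _; rewrite ler_piMl ?hnorm_ge0//.
by rewrite /hnorm; case: (b_unit k) => ->; rewrite ?ip0l// ?sqrtr0 ?sqrtr1.
Qed.

(** [linspan] allows repeated and scattered indices, whereas the coordinatewise estimate runs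
    through an initial segment; orthogonality recomputes the coefficients, and vanishing [b k] do no
    harm by [ip_b_scale]. *)
Lemma linspan_b_expand D : linspan b D ->
  exists n, D = \sum_(0 <= k < n) ip (b k) D *: b k.
Proof.
move=> [s [c ->]].
have [n sn] : exists n, forall k, k \in s -> (k < n)%N.
  exists (\max_(k <- s) k).+1 => k ks; rewrite ltnS; exact: leq_bigmax_seq.
exists n; under [RHS]eq_bigr do rewrite (ip_sumr ipP) scaler_suml.
rewrite exchange_big/= big_seq [RHS]big_seq; apply: eq_bigr => j js.
rewrite (bigD1_seq j) ?mem_index_iota ?sn ?iota_uniq//= big1 ?addr0.
  by rewrite (ipZr ipP) -scalerA ip_b_scale.
by move=> k kj; rewrite (ipZr ipP) b_orth// mulr0 scale0r.
Qed.

Variables (F : V -> R[i]) (N : R) (ep : R^nat).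
Hypotheses (N0 : 0 <= N) (ep0 : forall k, 0 <= ep k) (ep_sum : cvgn (series ep)).
Hypothesis dF : forall k x, cderivable F x (b k).
Hypothesis FN : forall k x, modulus (cderive F (b k) x) <= N * ep k.

Lemma lipschitz_coord k x (t : R) : modulus (F (t *: b k + x) - F x) <= N * (ep k * `|t|).
Proof. by rewrite mulrA; exact: directional_lipschitz. Qed.

Lemma lipschitz_span n x (t : R^nat) :
  modulus (F (\sum_(0 <= k < n) t k *: b k + x) - F x) <= N * \sum_(0 <= k < n) ep k * `|t k|.
Proof.
elim: n => [|n IH]; first by rewrite !big_geq// add0r subrr mulr0 modulusE /= expr0n addr0 sqrtr0.
rewrite !big_nat_recr//= mulrDr [leRHS]addrC -addrA addrCA.
set y := \sum_(0 <= k < n) t k *: b k + x in IH *.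
have -> : F (t n *: b n + y) - F x = (F (t n *: b n + y) - F y) + (F y - F x).
  by rewrite subrKA.
apply: le_trans (modulusD _ _) _; apply: lerD => //; exact: lipschitz_coord.
Qed.

Hypothesis b_dense : dense (linspan b).
Hypothesis cF : ccontinuous F.

Lemma ccontinuous_near x (e : R) : 0 < e -> \forall y \near x, modulus (F x - F y) < e.
Proof.
move=> e0; have e2 : 0 < e / 2 by rewrite divr_gt0.
near=> y; apply: le_lt_trans (modulus_le_ReIm _) _; rewrite ReB ImB.
have -> : e = e / 2 + e / 2 by field.
apply: ltrD; near: y; apply: cvgr_dist_lt => //; [exact: cF.1|exact: cF.2].
Unshelve. all: by end_near. Qed.

(** [x - y] is approached by a finite combination [D], for which the estimate is known. Coefficients
    of [D] differ from those of [x - y] by at most the [hnorm] distance, uniformly in [k], so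
    summability of [ep] controls the total error. *)
Lemma lipschitz_series x y : cvgn (series (fun k => ep k * `|ip (b k) (x - y)|)) /\
  modulus (F x - F y) <= N * limn (series (fun k => ep k * `|ip (b k) (x - y)|)).
Proof.
set u := fun k => _.
have u0 k : 0 <= u k by rewrite mulr_ge0.
have cu : cvgn (series u).
  apply: (@series_le_cvg _ _ (fun k => hnorm ip (x - y) * ep k)) => // [k|k|].
  - by rewrite mulr_ge0 ?hnorm_ge0.
  - by rewrite /u mulrC ler_wpM2r// ip_b_le.
  - have -> : (fun k => hnorm ip (x - y) * ep k) = hnorm ip (x - y) *: ep by [].
    exact: is_cvg_seriesZ.
split=> //.
pose S := limn (series ep).
have S0 : 0 <= S by apply: le_trans (series_le_lim 0 ep0 ep_sum); rewrite big_geq.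
apply/ler_addgt0Pr => e e0.
(* The total error is [eta * (1 + N * S)]: 1 from the continuity of [F], [N * S] from the error on
   the coefficients. *)
have NS0 : 0 < 1 + N * S by rewrite ltr_pwDl// mulr_ge0.
pose eta := e / (1 + N * S).
have eta0 : 0 < eta by rewrite divr_gt0.
have [C C0 hC] := hnorm_bounded ipP.
have near1 : \forall D \near (x - y), modulus (F x - F (D + y)) < eta /\ hnorm ip (x - y - D) < eta.
  near=> D; split.
    near: D.
    have := @cvgD _ _ _ _ _ id (fun _ => y) (x - y) y (@cvg_id _ _) (cvg_cst _).
    rewrite subrK => /(_ _ _ [set z | modulus (F x - F z) < eta]); apply.
    exact: ccontinuous_near.
  apply: le_lt_trans (hC _) _; rewrite mulrC -ltr_pdivlMr//.
  near: D; apply: cvgr_dist_lt; [exact: cvg_id|exact: divr_gt0].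
have [D [/interior_subset[/= D1 D2] /linspan_b_expand[n DE]]] :
   interior [set D | modulus (F x - F (D + y)) < eta /\ hnorm ip (x - y - D) < eta]
     `&` linspan b !=set0.
  by apply: b_dense; [exists (x - y)|exact: open_interior].
have -> : F x - F y = (F x - F (D + y)) + (F (D + y) - F y) by rewrite subrKA.
apply: le_trans (modulusD _ _) _.
apply: (@le_trans _ _ (eta + N * (limn (series u) + eta * S))); last first.
  rewrite mulrDr addrCA lerD2l.
  have -> : eta + N * (eta * S) = e by rewrite /eta; field; rewrite gt_eqF.
  by [].
apply: lerD; first exact: ltW.
rewrite {1}DE; apply: le_trans (lipschitz_span _ _ _) _; rewrite ler_wpM2l//.
apply: (@le_trans _ _ (\sum_(0 <= k < n) (u k + eta * ep k))).
  apply: ler_sum => k _; rewrite /u [eta * _]mulrC -mulrDr ler_wpM2l//.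
  rewrite -[D in X in X <= _](subKr (x - y)) (ipBr ipP (x - y)).
  apply: le_trans (ler_normB _ _) _.
  by rewrite lerD2l (le_trans (ip_b_le _ _))// ltW.
rewrite big_split/= -mulr_sumr; apply: lerD; first exact: series_le_lim.
by rewrite ler_wpM2l ?(ltW eta0)// series_le_lim.
Unshelve. all: by end_near. Qed.

End Lipschitz.

(** * The extension *)

Section Extension.
Context {R : realType} {V W : normedModType R}.
Variable ip : V -> V -> R.
Hypothesis ipP : inner_product ip.
Variable b : nat -> V.
Hypothesis b_orth : forall j k, j != k -> ip (b j) (b k) = 0.
Hypothesis b_unit : forall k, b k = 0 \/ ip (b k) (b k) = 1.
Hypothesis b_dense : dense (linspan b).
Variables (F : V -> R[i]) (N : R) (ep : R^nat).
Hypotheses (N0 : 0 <= N) (ep0 : forall k, 0 <= ep k) (ep_sum : cvgn (series ep)).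
Hypothesis dF : forall k x, cderivable F x (b k).
Hypothesis FN : forall k x, modulus (cderive F (b k) x) <= N * ep k.
Hypothesis cF : ccontinuous F.
Variable C : R.
Hypothesis FC : forall x, modulus (F x) <= C.
Variable phi : nat -> W -> R.
Hypothesis phi_cont : forall k, continuous (phi k).
(** Automatic when [b k] is a unit vector; when [b k = 0] it forces [phi k] to vanish. *)
Hypothesis phi_b : forall k x, phi k x * ip (b k) (b k) = phi k x.

Definition phi_summable (x : W) : Prop :=
  (\sum_(0 <= k <oo) (ep k * `|phi k x|)%:E < +oo)%E.

Definition phi_partial (n : nat) (x : W) : V := \sum_(0 <= k < n) phi k x *: b k.

(** The value 0 outside the measurable set [phi_summable] makes the function defined, measurable and
    bounded everywhere, with no measure in its definition. *)
Definition extension (x : W) : R[i] :=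
  if `[< phi_summable x >]
  then (limn (fun n => complex.Re (F (phi_partial n x))) +i*
        limn (fun n => complex.Im (F (phi_partial n x))))%C
  else 0.

Let term_ge0 k x : 0 <= ep k * `|phi k x|.
Proof. by rewrite mulr_ge0. Qed.

Lemma phi_summable_cvg x : phi_summable x -> cvgn (series (fun k => ep k * `|phi k x|)).
Proof. exact: nnseries_is_cvg. Qed.

Lemma phi_partial_step x k :
  modulus (F (phi_partial k.+1 x) - F (phi_partial k x)) <= N * (ep k * `|phi k x|).
Proof.
rewrite /phi_partial big_nat_recr//= [X in F X - _]addrC; exact: (lipschitz_coord dF FN).
Qed.

Lemma cvg_of_step (u : R^nat) x : phi_summable x ->
  (forall k, `|u k.+1 - u k| <= N * (ep k * `|phi k x|)) -> cvgn u.
Proof.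
move=> Sx ustep.
have cs : cvgn (series (telescope u)).
  apply: normed_cvg.
  apply: (@series_le_cvg _ _ (fun k => N * (ep k * `|phi k x|))) => [k|k|k|].
  - exact: normr_ge0.
  - by rewrite mulr_ge0.
  - exact: ustep.
  have -> : (fun k => N * (ep k * `|phi k x|)) = N *: (fun k => ep k * `|phi k x|) by [].
  by apply: is_cvg_seriesZ; exact: phi_summable_cvg.
have -> : u = (fun n => u 0%N + series (telescope u) n).
  by apply/funext => n; rewrite -eq_sum_telescope.
by apply: is_cvgD => //; exact: is_cvg_cst.
Qed.

Lemma cvg_Re_partial x : phi_summable x -> cvgn (fun n => complex.Re (F (phi_partial n x))).
Proof.
move=> Sx; apply: (cvg_of_step Sx) => k.
by apply: le_trans (phi_partial_step x k); rewrite -ReB; exact: Re_le_modulus.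
Qed.

Lemma cvg_Im_partial x : phi_summable x -> cvgn (fun n => complex.Im (F (phi_partial n x))).
Proof.
move=> Sx; apply: (cvg_of_step Sx) => k.
by apply: le_trans (phi_partial_step x k); rewrite -ImB; exact: Im_le_modulus.
Qed.

Lemma measurable_phi_summable : measurable ([set x : borel W | phi_summable x]).
Proof.
have mS : measurable_fun [set: borel W]
    (fun x : borel W => \sum_(0 <= k <oo) (ep k * `|phi k x|)%:E)%E.
  apply: ge0_emeasurable_sum => [k x _ _|k _]; first by rewrite lee_fin.
  apply/measurable_EFinP; apply: measurable_funM => //.
  by apply: measurableT_comp => //; exact: continuous_borel_measurable.
rewrite -[X in measurable X]setTI.
exact: emeasurable_fun_infty_o.
Qed.

Let measurable_limn_part (part : R[i] -> R) :
  continuous (fun v => part (F v)) -> part 0 = 0 ->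
  (forall x, phi_summable x -> cvgn (fun n => part (F (phi_partial n x)))) ->
  measurable_fun [set: borel W] (fun x : borel W =>
    if `[< phi_summable x >] then limn (fun n => part (F (phi_partial n x))) else 0).
Proof.
move=> cpart part0 cvg_part.
(* The indicator forces convergence at every point, so that measurability passes to the limit. *)
pose hh (n : nat) (x : borel W) : R :=
  part (F (phi_partial n x)) * \1_[set x : borel W | phi_summable x] x.
apply: (@measurable_fun_cvg _ _ _ _ hh).
  move=> n; apply: measurable_funM.
    rewrite /phi_partial.
    under eq_fun do rewrite big_mkord.
    apply: (measurable_continuous_sum (fun j : 'I_n => b j) cpart) => j.
    exact: continuous_borel_measurable.
  by apply: measurable_indic; exact: measurable_phi_summable.
move=> x _; rewrite /hh; case: asboolP => Sx.
  under eq_fun do rewrite indicE mem_set// mulr1.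
  exact: cvg_part.
under eq_fun do rewrite indicE memNset// mulr0.
exact: cvg_cst.
Qed.

Lemma measurable_Re_extension :
  measurable_fun [set: borel W] (fun x : borel W => complex.Re (extension x)).
Proof.
have := @measurable_limn_part (@complex.Re R) cF.1 erefl cvg_Re_partial.
apply: eq_measurable_fun => x _; rewrite /extension; by case: ifP.
Qed.

Lemma measurable_Im_extension :
  measurable_fun [set: borel W] (fun x : borel W => complex.Im (extension x)).
Proof.
have := @measurable_limn_part (@complex.Im R) cF.2 erefl cvg_Im_partial.
apply: eq_measurable_fun => x _; rewrite /extension; by case: ifP.
Qed.

(** The factor 2 comes from bounding the real and imaginary limits separately; finiteness of the L^q
    norms is all that is required. *)
Lemma extension_bounded x : modulus (extension x) <= 2 * C.
Proof.
have C0 : 0 <= C by apply: le_trans (FC 0); exact: modulus_ge0.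
have lim_le (u : R^nat) : cvgn u -> (forall n, `|u n| <= C) -> `|limn u| <= C.
  move=> cu uC; rewrite ler_norml; apply/andP; split.
    by apply: limr_ge => //; apply: nearW => n; have /ler_normlP[]:= uC n; rewrite lerNl.
  by apply: limr_le => //; apply: nearW => n; have /ler_normlP[]:= uC n.
rewrite /extension; case: asboolP => Sx; last first.
  by rewrite modulusE /= expr0n addr0 sqrtr0 mulr_ge0.
apply: le_trans (modulus_le_ReIm _) _; rewrite mulr_natl mulr2n; apply: lerD => /=.
  apply: lim_le => [|n]; first exact: cvg_Re_partial.
  by apply: le_trans (FC (phi_partial n x)); exact: Re_le_modulus.
apply: lim_le => [|n]; first exact: cvg_Im_partial.
by apply: le_trans (FC (phi_partial n x)); exact: Im_le_modulus.
Qed.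

Lemma extension_near x (e : R) : phi_summable x -> 0 < e ->
  \forall n \near \oo, modulus (F (phi_partial n x) - extension x) < e.
Proof.
move=> Sx e0; have e2 : 0 < e / 2 by rewrite divr_gt0.
near=> n; apply: le_lt_trans (modulus_le_ReIm _) _; rewrite ReB ImB.
have -> : e = e / 2 + e / 2 by field.
rewrite /extension asboolT//=; apply: ltrD; rewrite distrC; near: n; apply: cvgr_dist_lt => //.
  exact: cvg_Re_partial.
exact: cvg_Im_partial.
Unshelve. all: by end_near. Qed.

Lemma ip_b_partial k n x : ip (b k) (phi_partial n x) = if (k < n)%N then phi k x else 0.
Proof.
rewrite /phi_partial (ip_sumr ipP) big_mkord; case: ltnP => kn; last first.
  by rewrite big1// => j _; rewrite (ipZr ipP) b_orth ?mulr0// gtn_eqF// (leq_trans _ kn).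
rewrite (bigD1 (Ordinal kn))//= big1 ?addr0 => [|j jk]; first by rewrite (ipZr ipP) phi_b.
rewrite (ipZr ipP) b_orth ?mulr0//.
by rewrite eq_sym; apply: contra jk => /eqP jk; apply/eqP/val_inj.
Qed.

(** The limit in [n] of the Lipschitz estimate between [y] and [phi_partial n x]. The coordinates of
    [phi_partial n x] are [phi k x] up to [n] and 0 afterwards, so the defect is a tail of the
    convergent series [B]. *)
Lemma extension_estimate x y : phi_summable x ->
  cvgn (series (fun k => ep k * `|ip (b k) y - phi k x|)) /\
  modulus (F y - extension x) <= N * limn (series (fun k => ep k * `|ip (b k) y - phi k x|)).
Proof.
move=> Sx.
set A := fun k => ep k * _.
pose B k := ep k * `|phi k x|.
have A0 k : 0 <= A k by rewrite mulr_ge0.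
have cB : cvgn (series B) by exact: phi_summable_cvg.
have cY : cvgn (series (fun k => ep k * `|ip (b k) y|)).
  have [+ _] := lipschitz_series ipP b_orth b_unit N0 ep0 ep_sum dF FN b_dense cF y 0.
  by under eq_fun do rewrite subr0.
have cA : cvgn (series A).
  apply: (@series_le_cvg _ _ (fun k => ep k * `|ip (b k) y| + B k)) => // [k|k|].
  - by rewrite addr_ge0 ?mulr_ge0.
  - by rewrite /A /B -mulrDr ler_wpM2l// ler_normB.
  - have -> : (fun k => ep k * `|ip (b k) y| + B k) = (fun k => ep k * `|ip (b k) y|) + B by [].
    exact: is_cvg_seriesD.
split=> //.
(* For [k < n] the terms are [A k]; for [k >= n] the triangle inequality gives [A k + B k]. *)
have Fn n : modulus (F y - F (phi_partial n x)) <=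
    N * (limn (series A) + (limn (series B) - series B n)).
  have [cu /le_trans] :=
    lipschitz_series ipP b_orth b_unit N0 ep0 ep_sum dF FN b_dense cF y (phi_partial n x).
  apply; rewrite ler_wpM2l//; apply: limr_le => //; exists n => // m /= nm.
  apply: (@le_trans _ _ (\sum_(0 <= k < m) A k + \sum_(n <= k < m) B k)); last first.
    apply: lerD; first exact: series_le_lim.
    rewrite lerBrDl seriesEnat/= -(big_cat_nat (leq0n n) nm); apply: series_le_lim => // k.
    exact: term_ge0.
  rewrite seriesEnat/= !(big_cat_nat (leq0n n) nm)/= -addrA; apply: lerD.
    rewrite !big_nat; apply: ler_sum => k /andP[_ kn].
    by rewrite (ipBr ipP) ip_b_partial kn.
  rewrite -big_split/= !big_nat; apply: ler_sum => k /andP[nk _].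
  rewrite (ipBr ipP) ip_b_partial ltnNge nk subr0 /A /B -mulrDr ler_wpM2l//.
  by rewrite -{1}[ip (b k) y](subrK (phi k x)) ler_normD.
apply/ler_addgt0Pr => e e0.
have e2 : 0 < e / 2 by rewrite divr_gt0.
have /filter_ex[n [n1 n2]] : \forall n \near \oo,
    modulus (F (phi_partial n x) - extension x) < e / 2 /\
   N * (limn (series B) - series B n) < e / 2.
  near=> n; split; first by near: n; exact: extension_near.
  near: n.
  have : N * (limn (series B) - series B n) @[n --> \oo] --> (0 : R).
    rewrite -[X in _ --> X](mulr0 N); apply: cvgMr.
    rewrite -[X in _ --> X](subrr (limn (series B))); apply: cvgB => //; exact: cvg_cst.
  by move=> H; exact: (@cvgr_lt _ _ _ _ _ _ H).
have -> : F y - extension x = (F y - F (phi_partial n x)) + (F (phi_partial n x) - extension x).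
  by rewrite subrKA.
apply: le_trans (modulusD _ _) _.
have := Fn n; rewrite mulrDr; lra.
Unshelve. all: by end_near. Qed.

End Extension.

(** * Stochastic extension along increasing subspaces *)

Section ProjectionDistance.
Context {R : realType} {V : normedModType R} (ip : V -> V -> R).
Hypothesis ipP : inner_product ip.
Variables (b : nat -> V) (ep : R^nat).
Hypothesis b_unit : forall k, b k = 0 \/ ip (b k) (b k) = 1.
Hypotheses (ep0 : forall k, 0 <= ep k) (ep_sum : cvgn (series ep)).

Lemma hnorm_b_le k : hnorm ip (b k) <= 1.
Proof. by rewrite /hnorm; case: (b_unit k) => ->; rewrite ?(ip0l ipP) ?sqrtr0 ?sqrtr1. Qed.

Section OneSubspace.
Variables (E : set V) (n : nat) (w : 'I_n -> V).
Hypothesis wE : orthonormal_basis ip E w.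

Lemma proj_dist_le1 k : hnorm ip (b k - orthoproj ip E (b k)) <= 1.
Proof.
apply: le_trans (hnorm_b_le k); rewrite -[X in _ <= hnorm ip X]subr0.
apply: (orthoproj_le ipP wE); case: wE => _ <-.
by exists [::], (fun=> 0); rewrite big_nil.
Qed.

Lemma proj_dist_summable : cvgn (series (fun k => ep k * hnorm ip (b k - orthoproj ip E (b k)))).
Proof.
apply: (@series_le_cvg _ _ ep) => // k; first by rewrite mulr_ge0 ?hnorm_ge0.
by rewrite ler_piMr// proj_dist_le1.
Qed.

End OneSubspace.

(** Distances are at most 1, so the tail is small uniformly in [n]; each of the finitely many
    remaining distances tends to 0, because a nearby point of some [E N] stays in all later
    subspaces. *)
Lemma proj_dist_cvg0 (E : nat -> set V) (d : nat -> nat) (w : forall n, 'I_(d n) -> V) :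
  (forall n, E n `<=` E n.+1) -> dense (\bigcup_n E n) ->
  (forall n, orthonormal_basis ip (E n) (w n)) ->
  limn (series (fun k => ep k * hnorm ip (b k - orthoproj ip (E n) (b k)))) @[n --> \oo]
    --> (0 : R).
Proof.
move=> En Ed wE.
have Emono n m : (n <= m)%N -> E n `<=` E m.
  move=> nm; rewrite -subsetEset; move: n m nm.
  by apply/nondecreasing_seqP => n; rewrite subsetEset.
pose S := limn (series ep).
have S0 : 0 <= S by apply: le_trans (series_le_lim 0 ep0 ep_sum); rewrite big_geq.
apply/cvgrPdist_le => e e0.
(* The head contributes at most [S * eta <= e / 2]; adding 1 keeps the denominator positive. *)
pose eta := e / 2 / (S + 1).
have S1 : 0 < S + 1 by rewrite ltr_wpDl.
have eta0 : 0 < eta by rewrite !divr_gt0.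
have [C C0 hC] := hnorm_bounded ipP.
have [m Sm] : exists m, S - series ep m < e / 2.
  have : \forall m \near \oo, S - series ep m < e / 2.
    have : S - series ep m @[m --> \oo] --> S - S by apply: cvgB => //; exact: cvg_cst.
    by rewrite subrr => H; apply: (@cvgr_lt _ _ _ _ _ _ H); rewrite divr_gt0.
  by move=> /filter_ex.
have near_k k : \forall n \near \oo, hnorm ip (b k - orthoproj ip (E n) (b k)) <= eta.
  have : \forall z \near b k, hnorm ip (b k - z) < eta.
    near=> z; apply: le_lt_trans (hC _) _; rewrite mulrC -ltr_pdivlMr//.
    near: z; apply: cvgr_dist_lt; [exact: cvg_id|exact: divr_gt0].
  move=> near_b.
  have [z [/interior_subset/= bz [N _ ENz]]] :
      interior [set z | hnorm ip (b k - z) < eta] `&` \bigcup_n E n !=set0.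
    by apply: Ed; [exists (b k)|exact: open_interior].
  exists N => // n /= Nn; apply: le_trans (ltW bz).
  by apply: (orthoproj_le ipP (wE n)); exact: Emono ENz.
have near_all : \forall n \near \oo,
    forall k : 'I_m, hnorm ip (b k - orthoproj ip (E n) (b k)) <= eta.
  by apply: filter_forall => k; exact: near_k.
apply: filterS near_all => n dn.
set u := fun k => _.
have u0 k : 0 <= u k by rewrite mulr_ge0 ?hnorm_ge0.
have cu : cvgn (series u) by exact: proj_dist_summable (wE n).
rewrite sub0r normrN ger0_norm; last first.
  by apply: limr_ge => //; apply: nearW => k; rewrite seriesEnat/= sumr_ge0.
apply: limr_le => //; exists m => // K /= mK.
rewrite seriesEnat/= (big_cat_nat (leq0n m) mK)/=.
have -> : e = e / 2 + e / 2 by field.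
apply: lerD.
  apply: (@le_trans _ _ (\sum_(0 <= k < m) ep k * eta)).
    by rewrite !big_mkord; apply: ler_sum => k _; rewrite ler_wpM2l.
  rewrite -mulr_suml; apply: (@le_trans _ _ (S * eta)).
    by rewrite ler_wpM2r ?(ltW eta0)// series_le_lim.
  by rewrite /eta mulrCA ler_piMr ?divr_ge0 ?ltW// ltr_pdivrMr// mul1r ltrDl.
apply: le_trans (ltW Sm); rewrite lerBrDl.
apply: le_trans (series_le_lim K ep0 ep_sum); rewrite seriesEnat/= (big_cat_nat (leq0n m) mK)/= lerD2l.
by apply: ler_sum => k _; rewrite ler_piMr// (proj_dist_le1 (wE n)).
Unshelve. all: by end_near. Qed.

End ProjectionDistance.

Section StochasticExtension.
Context {R : realType} {V W : normedModType R}.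
Variables (ip : V -> V -> R) (i : V -> W).
Hypotheses (ipP : inner_product ip) (di : dense (range i)).
Variable b : nat -> V.
Hypothesis b_orth : forall j k, j != k -> ip (b j) (b k) = 0.
Hypothesis b_unit : forall k, b k = 0 \/ ip (b k) (b k) = 1.
Hypothesis b_dense : dense (linspan b).
Variables (F : V -> R[i]) (N : R) (ep : R^nat).
Hypotheses (N0 : 0 <= N) (ep0 : forall k, 0 <= ep k) (ep_sum : cvgn (series ep)).
Hypothesis dF : forall k x, cderivable F x (b k).
Hypothesis FN : forall k x, modulus (cderive F (b k) x) <= N * ep k.
Hypothesis cF : ccontinuous F.
Variable C : R.
Hypothesis FC : forall x, modulus (F x) <= C.
Variable phi : nat -> {linear W -> R^o}.
Hypothesis phiP : forall k, dual_repr ip i (phi k) (b k).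

Let ph (k : nat) (x : W) : R := phi k x.

Let ph_cont k : continuous (ph k). Proof. by case: (phiP k). Qed.

Let ph_b k x : ph k x * ip (b k) (b k) = ph k x.
Proof.
case: (b_unit k) => [b0|->]; last by rewrite mulr1.
by have := phiP k; rewrite b0 /ph => /(dual_repr0 ipP di) ->; rewrite mul0r.
Qed.

Let Ft := extension b F ep ph.

Lemma dense_dual_span : dense [set a | in_dual ip i a].
Proof.
move=> O O0 Oop; have [a [Oa [s [c ac]]]] := b_dense O0 Oop.
exists a; split=> //; have [k [ka _]] := dual_repr_sum ipP s c phiP.
by exists k; rewrite ac.
Qed.

Context (h : R) (P : probability (borel W) R) (ell : V -> W -> R).
Hypotheses (h0 : 0 < h) (PW : wiener_measure ip i h P).
Hypothesis ellP : is_ell ip i P ell.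

Let dd := dense_dual_span.

(** Case [q = 1] of [wiener_Lnorm]: each [|phi k|] has mean at most [K], since [b k] has norm at
    most 1, so the series has mean at most [K] times the sum of [ep]. *)
Lemma ae_phi_summable : {ae P, forall x : borel W, phi_summable ep ph x}.
Proof.
have mph k : measurable_fun [set: borel W] (ph k : borel W -> R).
  exact: continuous_borel_measurable.
have mterm k : measurable_fun [set: borel W] (fun x : borel W => (ep k * `|ph k x|)%:E).
  apply/measurable_EFinP; apply: measurable_funM => //.
  exact: measurableT_comp.
have mS : measurable_fun [set: borel W]
    (fun x : borel W => \sum_(0 <= k <oo) (ep k * `|ph k x|)%:E)%E.
  by apply: ge0_emeasurable_sum => [k x _ _|k _] //; rewrite lee_fin mulr_ge0.
have S0 (x : borel W) : (0 <= \sum_(0 <= k <oo) (ep k * `|ph k x|)%:E)%E.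
  by apply: nneseries_ge0 => k _ _; rewrite lee_fin mulr_ge0.
pose K : R := Kconst 1 * h `^ (1 / 2).
have K0 : 0 <= K by exact: Kconst_powR_ge0.
have S_int : P.-integrable [set: borel W]
    (fun x : borel W => \sum_(0 <= k <oo) (ep k * `|ph k x|)%:E)%E.
  apply/integrableP; split => //.
  under eq_integral do rewrite (gee0_abs (S0 _)).
  rewrite integral_nneseries//; last by move=> k x _; rewrite lee_fin mulr_ge0.
  apply: (@le_lt_trans _ _ (K * limn (series ep))%:E); last exact: ltry.
  apply: lime_le.
    by apply: is_cvg_nneseries => k _ _; apply: integral_ge0 => x _; rewrite lee_fin mulr_ge0.
  apply: nearW => n.
  apply: (@le_trans _ _ (\sum_(0 <= k < n) (K * ep k)%:E)%E).
    apply: lee_sum => k _.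
    under eq_integral do rewrite EFinM.
    rewrite ge0_integralZl//; last 2 first.
    - by apply/measurable_EFinP; exact: measurableT_comp.
    - by rewrite lee_fin.
    rewrite mulrC EFinM; apply: lee_wpmul2l; first by rewrite lee_fin.
    have := wiener_Lnorm ipP h0 PW (lexx 1) di (phiP k).
    rewrite Lnorm1 => /le_trans; apply; rewrite lee_fin -/K ler_piMr//.
    exact: hnorm_b_le.
  rewrite sumEFin lee_fin -mulr_sumr ler_wpM2l//.
  exact: series_le_lim.
apply: filterS (integrable_ae measurableT S_int) => x /(_ I).
by rewrite ge0_fin_numE.
Qed.

Lemma measurable_modulus (g : W -> R[i]) :
  measurable_fun [set: borel W] (fun x : borel W => complex.Re (g x)) ->
  measurable_fun [set: borel W] (fun x : borel W => complex.Im (g x)) ->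
  measurable_fun [set: borel W] (fun x : borel W => modulus (g x)).
Proof.
move=> mR mI; under eq_fun do rewrite modulusE.
apply: (@measurableT_comp _ _ _ _ _ _ (@Num.sqrt R)).
  by apply: continuous_measurable_fun; exact: sqrt_continuous.
by apply: measurable_funD; apply: measurable_funX.
Qed.

Lemma bounded_in_cLp (q : R) (g : W -> R[i]) (M : R) : 1 <= q ->
  measurable_fun [set: borel W] (fun x : borel W => complex.Re (g x)) ->
  measurable_fun [set: borel W] (fun x : borel W => complex.Im (g x)) ->
  (forall x, modulus (g x) <= M) -> in_cLp P q g.
Proof.
move=> q1 mR mI gM; split=> //.
have q0 : 0 < q by exact: lt_le_trans q1.
have M0 : 0 <= M by apply: le_trans (gM 0); exact: modulus_ge0.
rewrite /cLnorm; apply: (@le_lt_trans _ _ M%:E); last exact: ltry.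
apply: (le_Lnorm_powR (f := fun x : borel W => modulus (g x))) => //.
apply: (@le_trans _ _ (\int[P]_x (cst (M `^ q)%:E x))%E); last first.
  by rewrite integral_cst//= (@probability_setT _ _ _ P) mule1.
apply: ge0_le_integral => //.
- apply/measurable_EFinP; apply: (measurableT_comp (measurable_powR _)).
  by apply: measurableT_comp => //; exact: measurable_modulus.
- move=> x _; rewrite lee_fin; apply: (ge0_ler_powR (ltW q0)); rewrite ?nnegrE//.
  by rewrite ger0_norm ?modulus_ge0.
Qed.

Section OneSubspace.
Variables (E : set V) (n : nat) (w : 'I_n -> V).
Hypothesis wE : orthonormal_basis ip E w.

Lemma measurable_Re_tilde : measurable_fun [set: borel W]
  (fun x : borel W => complex.Re ((F \o tilde_proj ell w) x)).
Proof.
apply: (measurable_continuous_sum (g := fun v => complex.Re (F v)) w cF.1) => j.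
exact: measurable_ell ellP _.
Qed.

Lemma measurable_Im_tilde : measurable_fun [set: borel W]
  (fun x : borel W => complex.Im ((F \o tilde_proj ell w) x)).
Proof.
apply: (measurable_continuous_sum (g := fun v => complex.Im (F v)) w cF.2) => j.
exact: measurable_ell ellP _.
Qed.

Lemma extension_Lnorm (q : R) : 1 <= q ->
  (cLnorm P q ((F \o tilde_proj ell w) \- Ft)%R <=
   (N * (Kconst q * h `^ (1 / 2)) *
     limn (series (fun k => ep k * hnorm ip (b k - orthoproj ip E (b k)))))%:E)%E.
Proof.
move=> q1; have q0 : 0 < q by exact: lt_le_trans q1.
set K := Kconst q * _.
have K0 : 0 <= K by exact: Kconst_powR_ge0.
have sd := proj_dist_summable ipP b_unit ep0 ep_sum wE.
set c := fun k => _ in sd *.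
pose c' k := N * K * c k.
have cc' : cvgn (series c').
  have -> : c' = (N * K) *: c by [].
  exact: is_cvg_seriesZ.
have -> : N * K * limn (series c) = limn (series c').
  have -> : c' = (N * K) *: c by [].
  by rewrite lim_seriesZ.
pose g k (x : borel W) : R := N * ep k * (ip (b k) (tilde_proj ell w x) - ph k x).
have tpE k x : ip (b k) (tilde_proj ell w x) = \sum_j ip (b k) (w j) * ell (w j) x.
  by rewrite /tilde_proj (ip_sumr ipP); apply: eq_bigr => j _; rewrite (ipZr ipP) mulrC.
have mph k : measurable_fun [set: borel W] (ph k : borel W -> R).
  exact: continuous_borel_measurable.
have mell a : measurable_fun [set: borel W] (ell a : borel W -> R).
  exact: measurable_ell ellP _.
have mtp k : measurable_fun [set: borel W] (fun x : borel W => ip (b k) (tilde_proj ell w x)).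
  under eq_fun do rewrite tpE.
  by apply: measurable_sum => j; exact: measurable_funM.
have mg k : measurable_fun [set: borel W] (g k).
  by apply: measurable_funM => //; exact: measurable_funB.
rewrite /cLnorm.
apply: (Lnorm_series_le
  (f := fun x : borel W => modulus ((F \o tilde_proj ell w) x - Ft x)) q1 _ mg) cc' _.
- apply: measurable_modulus.
    under eq_fun do rewrite ReB; apply: measurable_funB; first exact: measurable_Re_tilde.
    exact: (measurable_Re_extension N0 ep0 dF FN cF ph_cont).
  under eq_fun do rewrite ImB; apply: measurable_funB; first exact: measurable_Im_tilde.
  exact: (measurable_Im_extension N0 ep0 dF FN cF ph_cont).
- move=> k.
  (* The extra index adjoins [b k] to the basis [w], so that [g k] becomes, almost everywhere, one
     combination of values of [ell]; the corresponding vector is [N * ep k] times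
     [orthoproj ip E (b k) - b k]. *)
  pose cs (s : 'I_n + 'I_1) : R :=
    match s with inl j => N * ep k * ip (b k) (w j) | inr _ => - (N * ep k) end.
  pose ws (s : 'I_n + 'I_1) : V := match s with inl j => w j | inr _ => b k end.
  have csE : \sum_s cs s *: ws s = (N * ep k) *: (orthoproj ip E (b k) - b k).
    rewrite (orthoprojE ipP wE) big_sumType/= big_ord1/= scalerBr scaleNr scaler_sumr.
    by congr (_ - _); apply: eq_bigr => j _; rewrite scalerA.
  have NK : hnorm ip (\sum_s cs s *: ws s) = N * ep k * hnorm ip (b k - orthoproj ip E (b k)).
    rewrite csE (hnormZ ipP) ger0_norm ?mulr_ge0//.
    by rewrite (hnormBC ipP).
  have := @ell_sum_Lnorm _ _ _ _ _ ipP _ _ _ h0 PW ellP di dd q _ cs ws q1.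
  rewrite -/K NK (_ : K * _ = c' k); last by rewrite /c' /c; ring.
  apply: ae_Lnorm_le => //.
  + exact: mulr_ge0 (mulr_ge0 N0 K0) (mulr_ge0 (ep0 k) (hnorm_ge0 _ _)).
  + by apply: measurable_sum => s; exact: measurable_funM.
  have ell_b : {ae P, forall x : borel W, ell (b k) x = phi k x}.
    by case: ellP => _ + _; apply.
  apply: filterS ell_b => x ellx.
  rewrite /g tpE big_sumType/= big_ord1/= ellx mulrBr mulNr mulr_sumr.
  by congr (_ - _); apply: eq_bigr => j _; rewrite mulrA.
- apply: (@filterS _ (almost_everywhere P) _ _ _ _ ae_phi_summable) => x Sx.
  have [cx le_x] := extension_estimate ipP b_orth b_unit b_dense N0 ep0 ep_sum dF FN cF ph_b
    (tilde_proj ell w x) Sx.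
  have gE : (fun k => `|g k x|) = N *: (fun k => ep k * `|ip (b k) (tilde_proj ell w x) - ph k x|).
    by apply/funext => k; rewrite /g !normrM (ger0_norm N0) (ger0_norm (ep0 k)) -mulrA.
  rewrite gE; split; first exact: is_cvg_seriesZ.
  by rewrite lim_seriesZ// ger0_norm ?modulus_ge0.
Qed.

End OneSubspace.

Lemma extension_stochastic (q : R) : 1 <= q -> stochastic_extension ip P ell q F Ft.
Proof.
move=> q1; split.
- split; [exact: continuous_borel_measurable cF.1|exact: continuous_borel_measurable cF.2].
- apply: (bounded_in_cLp q1 (M := 2 * C)).
  + exact: (measurable_Re_extension N0 ep0 dF FN cF ph_cont).
  + exact: (measurable_Im_extension N0 ep0 dF FN cF ph_cont).
  + exact: (extension_bounded N0 ep0 dF FN FC).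
move=> E _ En Ed d w wE; split=> [n|].
  apply: (bounded_in_cLp q1 (M := C)).
  + exact: measurable_Re_tilde.
  + exact: measurable_Im_tilde.
  + by move=> x; exact: FC.
pose c n := N * (Kconst q * h `^ (1 / 2)) *
  limn (series (fun k => ep k * hnorm ip (b k - orthoproj ip (E n) (b k)))).
have c_cvg : (c n)%:E @[n --> \oo] --> 0%E.
  apply: cvg_EFin; first exact: nearW.
  rewrite -[X in _ --> X](mulr0 (N * (Kconst q * h `^ (1 / 2)))).
  by apply: cvgMr; exact: proj_dist_cvg0 wE.
apply: (@squeeze_cvge _ _ _ _ (fun=> 0%E) _ (fun n => (c n)%:E)) => //; last exact: cvg_cst.
apply: nearW => n; apply/andP; split; first exact: Lnorm_ge0.
exact: extension_Lnorm.
Qed.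

End StochasticExtension.

(** * Directions in the product space *)

Section Directions.
Context {R : realType} {J : countType}.

Lemma esum_setT_sum (a : J + J -> \bar R) : (forall d, 0 <= a d)%E ->
  \esum_(d in [set: J + J]) a d = \esum_(j in [set: J]) (a (inl j) + a (inr j))%E.
Proof.
move=> a0; rewrite (esumID (range inl)) ?setTI//.
have -> : ~` (range inl) = range (@inr J J).
  apply/seteqP; split=> [[j|j] /=|_ [j _ <-] [//]].
  - by move=> H; exfalso; apply: H; exists j.
  - by exists j.
rewrite !esum_image; first by rewrite esumD.
- by move=> j k _ _ [].
- by move=> j k _ _ [].
Qed.

(** Passage from series over natural codes to sums over a countable type: integers that code nothing
    contribute 0. *)
Lemma nneseries_pickle_inv (I : countType) (a : I -> \bar R) : (forall d, 0 <= a d)%E ->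
  (\sum_(0 <= k <oo) oapp a 0 (pickle_inv k) = \esum_(d in [set: I]) a d)%E.
Proof.
move=> a0; pose f k := (oapp a 0 (@pickle_inv I k))%E.
have f0 k : (0 <= f k)%E by rewrite /f; case: pickle_inv => /=.
rewrite nneseries_esumT// (esumID (range (@choice.pickle I))) ?setTI; last by move=> k _; exact: f0.
rewrite [X in (_ + X)%E]esum1 ?adde0; last first.
  move=> k /= nk; case E : (pickle_inv k) => [d|]//=.
  by exfalso; apply: nk; exists d => //; have := @pickle_invK I k; rewrite E.
rewrite esum_image; last by move=> d d' _ _; exact: (pcan_inj choice.pickleK).
by apply: eq_esum => d _; rewrite pickleK_inv.
Qed.

End Directions.

Lemma dense_setX {T1 T2 : topologicalType} (S1 : set T1) (S2 : set T2) :
  dense S1 -> dense S2 -> dense (S1 `*` S2).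
Proof.
move=> d1 d2 O [[x y] Oxy] Oop.
have [[A1 A2] /= [nA1 nA2] A12] : nbhs (x, y) O by apply: open_nbhs_nbhs.
have [u [/interior_subset A1u S1u]] := d1 _ (ex_intro _ x nA1) (open_interior A1).
have [v [/interior_subset A2v S2v]] := d2 _ (ex_intro _ y nA2) (open_interior A2).
by exists (u, v); split=> //; apply: A12.
Qed.

Section Pairs.
Context {R : realType} {H B : completeNormedModType R}.
Variables (ip : {dot H for idfun}) (i : {linear H -> B}).
Hypothesis ip_norm : forall x : H, `|x| = hnorm ip x.

Lemma dot_sym x y : ip x y = ip y x.
Proof. by rewrite hermC/= expr0 mul1r. Qed.

Lemma dot_linear (a : R) x y z : ip (a *: x + y) z = a * ip x z + ip y z.
Proof. by rewrite linearPl. Qed.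

Lemma dot_ge0 x : 0 <= ip x x.
Proof.
have [->|x0] := eqVneq x 0; last by rewrite ltW// neq0_dnorm_gt0.
by rewrite linear0l.
Qed.

Lemma dot_eq0 x : ip x x = 0 -> x = 0.
Proof.
move=> xx; apply/eqP; apply: contraT => x0.
have : 0 < ip x x by exact: neq0_dnorm_gt0.
by rewrite xx ltxx.
Qed.

Lemma inner_product_pair : inner_product (ip_pair ip).
Proof.
split.
- by move=> x y; rewrite /ip_pair (dot_sym x.1) (dot_sym x.2).
- by move=> a x y z; rewrite /ip_pair/= !dot_linear; ring.
- by move=> x; rewrite /ip_pair addr_ge0 ?dot_ge0.
- move=> [x y] /eqP; rewrite /ip_pair/= paddr_eq0 ?dot_ge0//.
  by move=> /andP[/eqP/dot_eq0 -> /eqP/dot_eq0 ->].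
(* The sum of two squares is at most twice the square of the maximum norm, so 2 is more than
   enough. *)
exists 2 => // x.
have sqN (y : H) : ip y y = `|y| ^+ 2 by rewrite ip_norm sqr_sqrtr// dot_ge0.
rewrite /hnorm /ip_pair !sqN -[leRHS]ger0_norm ?mulr_ge0// -sqrtr_sqr ler_wsqrtr//.
have n1 : `|x.1| <= `|x| by rewrite prod_normE le_max lexx.
have n2 : `|x.2| <= `|x| by rewrite prod_normE le_max lexx orbT.
have := normr_ge0 x.1; have := normr_ge0 x.2; nra.
Qed.

Lemma dense_range_pair : dense (range i) -> dense (range (map_pair i)).
Proof.
move=> di O O0 Oop; have [[u v] [Ouv [[x _ /= xu] [y _ /= yv]]]] := dense_setX di di O0 Oop.
by exists (u, v); split=> //; exists (x, y); rewrite // /map_pair /= xu yv.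
Qed.

Context {J : countType} (e : J -> H).
Hypotheses (he : hilbert_basis ip e) (heB : forall j, in_dual ip i (e j)).

(* Codes [k] of no direction give the zero vector, hence the alternative
   [b k = 0] in the hypotheses on [b] above. *)
Definition dir_seq (k : nat) : H * H := oapp (direction e) 0 (pickle_inv k).

Lemma ip_pair_direction d d' : ip_pair ip (direction e d) (direction e d') = (d == d')%:R.
Proof.
have [oe _] := he.
have ip0 x : ip 0 x = 0 by rewrite linear0l.
have ip0' x : ip x 0 = 0 by rewrite dot_sym ip0.
by case: d d' => j [j'|j']; rewrite /ip_pair/= ?ip0 ?ip0' ?addr0 ?add0r ?oe.
Qed.

Lemma dir_seq_orth j k : j != k -> ip_pair ip (dir_seq j) (dir_seq k) = 0.
Proof.
move=> jk; rewrite /dir_seq; have ipP := inner_product_pair.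
case Ej : (pickle_inv j) => [d|]/=; last by rewrite (ip0l ipP).
case Ek : (pickle_inv k) => [d'|]/=; last by rewrite (ip_sym ipP) (ip0l ipP).
rewrite ip_pair_direction; case: eqVneq => // dd'; move: jk.
have := @pickle_invK (J + J)%type j; have := @pickle_invK (J + J)%type k.
by rewrite Ej Ek /= dd' => -> ->; rewrite eqxx.
Qed.

Lemma dir_seq_unit k : dir_seq k = 0 \/ ip_pair ip (dir_seq k) (dir_seq k) = 1.
Proof.
rewrite /dir_seq; case: pickle_inv => [d|]/=; last by left.
by right; rewrite ip_pair_direction eqxx.
Qed.

Lemma dense_dir_seq : dense (linspan dir_seq).
Proof.
have [_ de] := he.
move=> O O0 Oop; have [[u v] [Ouv [[s [c /= us]] [t [d /= vt]]]]] := dense_setX de de O0 Oop.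
exists (u, v); split=> //.
pose cd (x : J + J) := match x with inl j => c j | inr j => d j end.
(* Both expansions are concatenated, each index being replaced by the code of its direction. *)
exists (map (@choice.pickle (J + J)%type) (map inl s ++ map inr t)),
  (fun k => oapp cd 0 (pickle_inv k)).
rewrite big_map big_cat/= !big_map/=.
under eq_bigr do rewrite /dir_seq pickleK_inv/=.
under [X in _ = _ + X]eq_bigr do rewrite /dir_seq pickleK_inv/=.
have fst_sum (r : seq J) (f : J -> H * H) : (\sum_(j <- r) f j).1 = \sum_(j <- r) (f j).1.
  exact: (big_morph (@fst H H)).
have snd_sum (r : seq J) (f : J -> H * H) : (\sum_(j <- r) f j).2 = \sum_(j <- r) (f j).2.
  exact: (big_morph (@snd H H)).
apply/pair_equal_spec; split.
  rewrite us /= !fst_sum [X in _ + X]big1 ?addr0 => [|j _]; last by rewrite /= scaler0.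
  by apply: eq_bigr.
rewrite vt /= !snd_sum [X in X + _]big1 ?add0r => [|j _]; last by rewrite /= scaler0.
by apply: eq_bigr.
Qed.

Lemma dual_dir_seq : exists f : nat -> {linear (B * B)%type -> R^o},
  forall k, dual_repr (ip_pair ip) (map_pair i) (f k) (dir_seq k).
Proof.
suff /choice[f fP] : forall k, exists g : {linear (B * B)%type -> R^o},
  dual_repr (ip_pair ip) (map_pair i) g (dir_seq k) by exists f.
have ip0 x : ip 0 x = 0 by rewrite linear0l.
move=> k; rewrite /dir_seq; case: pickle_inv => [[j|j]|]/=.
- have [f [cf fj]] := heB j.
  have fE : linear (fun x : B * B => f x.1 : R^o) by move=> a x y; rewrite /= linearP.
  pose g : {linear (B * B)%type -> R^o} := HB.pack (fun x : B * B => f x.1 : R^o)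
    (GRing.isLinear.Build _ _ _ _ _ fE).
  exists g; split=> [x|x]; last by rewrite /= fj /ip_pair/= ip0 addr0.
  apply: (@continuous_comp _ _ _ (fun x : B * B => x.1) f); first exact: cvg_fst.
  exact: cf.
- have [f [cf fj]] := heB j.
  have fE : linear (fun x : B * B => f x.2 : R^o) by move=> a x y; rewrite /= linearP.
  pose g : {linear (B * B)%type -> R^o} := HB.pack (fun x : B * B => f x.2 : R^o)
    (GRing.isLinear.Build _ _ _ _ _ fE).
  exists g; split=> [x|x]; last by rewrite /= fj /ip_pair/= ip0 add0r.
  apply: (@continuous_comp _ _ _ (fun x : B * B => x.2) f); first exact: cvg_snd.
  exact: cf.
by have [f [fP _]] := dual_repr_zero (map_pair i) inner_product_pair; exists f.
Qed.


(** * Weights along the directions and derivative bounds from the symbol norm *)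

Variable eps : J -> R.
Hypotheses (eps_ge0 : forall j, 0 <= eps j) (eps_sum : summable [set: J] (fun j => (eps j)%:E)).

Definition dir_eps (d : J + J) : R := match d with inl j | inr j => eps j end.
Definition eps_seq (k : nat) : R := oapp dir_eps 0 (pickle_inv k).

Lemma dir_eps_ge0 d : 0 <= dir_eps d. Proof. by case: d => j /=. Qed.

Lemma eps_seq_ge0 k : 0 <= eps_seq k.
Proof. by rewrite /eps_seq; case: pickle_inv => //= d; exact: dir_eps_ge0. Qed.

Lemma eps_seq_summable : cvgn (series eps_seq).
Proof.
apply: nnseries_is_cvg; first exact: eps_seq_ge0.
have -> : (\sum_(0 <= k <oo) (eps_seq k)%:E =
    \sum_(0 <= k <oo) oapp (EFin \o dir_eps) 0 (@pickle_inv (J + J)%type k))%E.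
  by apply: eq_eseriesr => k _; rewrite /eps_seq; case: pickle_inv.
have eps0 j : (0 <= (eps j)%:E)%E by rewrite lee_fin.
rewrite nneseries_pickle_inv ?esum_setT_sum//=; try by move=> d; rewrite lee_fin dir_eps_ge0.
rewrite esumD//; move: eps_sum; rewrite /summable.
under eq_esum do rewrite gee0_abs//.
by move=> ?; rewrite lte_add_pinfty.
Qed.

Lemma dist_series_le_esum (E : set (H * H)) :
  let dist x := hnorm (ip_pair ip) (x - orthoproj (ip_pair ip) E x) in
  cvgn (series (fun k => eps_seq k * dist (dir_seq k))) ->
  ((limn (series (fun k => eps_seq k * dist (dir_seq k))))%:E <=
   \esum_(j in [set: J]) (eps j * (dist (e j, 0)%R + dist (0, e j)%R))%:E)%E.
Proof.
move=> dist cv.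
have dist0 x : 0 <= dist x by exact: hnorm_ge0.
rewrite -EFin_lim//.
have -> : (EFin \o series (fun k => eps_seq k * dist (dir_seq k))) =
    (fun n => \sum_(0 <= k < n)
       oapp (fun d => (dir_eps d * dist (direction e d))%:E) 0%E (@pickle_inv (J + J)%type k))%E.
  apply/funext => n /=; rewrite seriesEnat/= -sumEFin; apply: eq_bigr => k _.
  by rewrite /eps_seq /dir_seq; case: pickle_inv => //=; rewrite mul0r.
rewrite nneseries_pickle_inv ?esum_setT_sum//=;
  try by move=> d; rewrite lee_fin mulr_ge0 ?dir_eps_ge0.
by apply: le_esum => j _; rewrite /= -EFinD lee_fin mulrDr.
Qed.

(** The multi-index with a single entry 1, on the side of [d], reduces the defining product to one
    weight. *)
Lemma symbol_class_direction (M : R) (F : H * H -> R[i]) d :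
  symbol_class e 1 M eps F ->
  (forall x, cderivable F x (direction e d)) /\
  (forall x, modulus (cderive F (direction e d) x) <= M * dir_eps d).
Proof.
move=> [_ _ FM].
pose j := match d with inl j | inr j => j end.
pose one : {fsfun J -> nat with 0%N} := [fsfun k in [fset j]%fset => 1%N | 0%N].
pose zero : {fsfun J -> nat with 0%N} := [fsfun k in fset0 => 1%N | 0%N].
have oneE k : one k = (k == j) by rewrite fsfunE inE; case: eqP.
have zeroE k : zero k = 0%N by rewrite fsfunE inE.
pose alpha := if d is inl _ then one else zero.
pose beta := if d is inl _ then zero else one.
have abE k : (alpha k + beta k)%N = (k == j).
  by rewrite /alpha /beta; case: (d) => _; rewrite oneE zeroE ?addn0.
have [|k|] := FM alpha beta _ [:: d].
- by move=> k; rewrite !(leq_trans _ (leq_b1 (k == j)))// -abE ?leq_addr ?leq_addl.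
- by rewrite /alpha /beta; case Ed : d => [l|l]; rewrite /= !addn0 oneE zeroE /j Ed eq_sym.
move=> /= [_ dF] _ FB; split=> // x; apply: le_trans (FB x) _.
have -> : (finsupp alpha `|` finsupp beta)%fset = [fset j]%fset.
  apply/fsetP => k; rewrite !inE !mem_finsupp; have := abE k.
  by case: eqP => _; case: (alpha k) => [|?]; case: (beta k) => [|?].
rewrite big_seq_fset1 abE eqxx expr1 /j.
by case: (d).
Qed.

(** For a positive weight, derivative over weight is a lower bound of all admissible [M], hence of
    their infimum, without knowing that the infimum is admissible. For weight 0 the derivative
    vanishes. *)
Lemma symbol_norm_derivative (F : H * H -> R[i]) d x :
  symbol_space e 1 eps F ->
  modulus (cderive F (direction e d) x) <= symbol_norm e 1 eps F * dir_eps d.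
Proof.
move=> [M0 M00 FM0].
have [d0|d0] := eqVneq (dir_eps d) 0.
  have [_ /(_ x)] := symbol_class_direction d FM0.
  by rewrite d0 !mulr0.
have {}d0 : 0 < dir_eps d by rewrite lt0r d0 dir_eps_ge0.
rewrite -ler_pdivrMr//; apply: lb_le_inf; first by exists M0.
move=> M [_ FM]; rewrite ler_pdivrMr//.
by have [_] := symbol_class_direction d FM.
Qed.

Lemma symbol_norm_ge0 (F : H * H -> R[i]) : symbol_space e 1 eps F -> 0 <= symbol_norm e 1 eps F.
Proof.
by move=> [M0 M00 FM0]; apply: lb_le_inf; [exists M0|move=> M []].
Qed.

Lemma cderivable_dir_seq (F : H * H -> R[i]) k x :
  symbol_space e 1 eps F -> cderivable F x (dir_seq k).
Proof.
move=> [M _ FM]; rewrite /dir_seq; case: pickle_inv => [d|]/=; last first.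
  by split; exact: derivable0.
by have [] := symbol_class_direction d FM.
Qed.

Lemma cderive_dir_seq (F : H * H -> R[i]) k x : symbol_space e 1 eps F ->
  modulus (cderive F (dir_seq k) x) <= symbol_norm e 1 eps F * eps_seq k.
Proof.
move=> FS; rewrite /dir_seq /eps_seq; case: pickle_inv => [d|].
  exact: symbol_norm_derivative.
by rewrite modulusE /cderive/= !derive0 expr0n addr0 sqrtr0 mulr0.
Qed.

End Pairs.

Theorem proposition3p1 (R : realType) (H B : completeNormedModType R)
  (ip : {dot H for idfun}) (i : {linear H -> B})
  (hHB : wiener_space ip i)
  (mu : R -> probability (borel (B * B)%type) R)
  (hmu : forall h, 0 < h -> wiener_measure (ip_pair ip) (map_pair i) h (mu h))
  (ell : R -> H * H -> B * B -> R)
  (hell : forall h, 0 < h -> is_ell (ip_pair ip) (map_pair i) (mu h) (ell h))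
  (J : countType) (e : J -> H)
  (he : hilbert_basis ip e) (heB : forall j, in_dual ip i (e j))
  (eps : J -> R) (eps_ge0 : forall j, 0 <= eps j)
  (eps_sum : summable [set: J] (fun j => (eps j)%:E))
  (F : H * H -> R[i]) (hF : symbol_space e 1 eps F) :
  (forall h q : R, 0 < h -> 1 <= q ->
     exists Ft : B * B -> R[i],
       stochastic_extension (ip_pair ip) (mu h) (ell h) q F Ft)
  /\
  (forall h0 q0 : R, 0 < h0 -> 1 < q0 ->
     exists Ft : B * B -> R[i],
       (forall h q : R, 0 < h <= h0 -> 1 <= q <= q0 ->
          stochastic_extension (ip_pair ip) (mu h) (ell h) q F Ft)
       /\
       (forall (E : set (H * H)) (n : nat) (w : 'I_n -> H * H),
          findim E -> orthonormal_basis (ip_pair ip) E w ->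
          forall h q : R, 0 < h <= h0 -> 1 <= q <= q0 ->
          (cLnorm (mu h) q ((F \o tilde_proj (ell h) w) \- Ft)%R
           <= (symbol_norm e 1 eps F * Kconst q * h `^ (1 / 2))%:E *
              \esum_(j in [set: J])
                (eps j *
                 (hnorm (ip_pair ip) ((e j, 0) - orthoproj (ip_pair ip) E (e j, 0))
                + hnorm (ip_pair ip)
                    ((0, e j) - orthoproj (ip_pair ip) E (0, e j))))%:E)%E)).

Proof.
have [ip_norm _ _ _ di] := hHB.
have ipP := inner_product_pair ip_norm.
have di2 := dense_range_pair di.
have [phi phiP] := dual_dir_seq ip_norm heB.
have b_orth := dir_seq_orth ip_norm he.
have b_unit := dir_seq_unit he.
have b_dense := dense_dir_seq he.
have ep0 := eps_seq_ge0 eps_ge0.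
have ep_sum := eps_seq_summable eps_ge0 eps_sum.
have N0 := symbol_norm_ge0 hF.
have dF k x := cderivable_dir_seq k x hF.
have FN k x := cderive_dir_seq eps_ge0 k x hF.
have [M _ [cF [C FC] _]] := hF.
(* None of [h], [q], [h0], [q0] enters [Ft], so this single function answers both existence
   claims. *)
pose Ft := extension (dir_seq e) F (eps_seq eps) (fun k x => phi k x).
have FtP h q : 0 < h -> 1 <= q -> stochastic_extension (ip_pair ip) (mu h) (ell h) q F Ft.
  move=> h0 q1.
  exact: (extension_stochastic ipP di2 b_orth b_unit b_dense N0 ep0 ep_sum dF FN cF FC phiP h0
    (hmu _ h0) (hell _ h0) q1).
split=> [h q h0 q1|h0 q0 _ _]; first by exists Ft; exact: FtP.
exists Ft; split=> [h q /andP[hp _] /andP[q1 _]|E n w _ wE h q /andP[hp _] /andP[q1 _]].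
  exact: FtP.
apply: le_trans (extension_Lnorm ipP di2 b_orth b_unit b_dense N0 ep0 ep_sum dF FN cF phiP hp
  (hmu _ hp) (hell _ hp) wE q1) _.
rewrite mulrA EFinM; apply: lee_wpmul2l.
  by rewrite lee_fin -mulrA mulr_ge0// Kconst_powR_ge0.
apply: dist_series_le_esum => //.
exact: (proj_dist_summable ipP b_unit ep0 ep_sum wE).
Qed.
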